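(* Given $a,b\in I_n$, there exist polynomial-time algorithms to check each of the following in $I_n$: $a\sim_i b$, $a\sim_p b$, $a\sim_{p^*} b$, and $a\sim_{tr} b$.
   Context: $[n]=\{1,\dots,n\}$. $I_n$ is the monoid of all bijections between subsets of $[n]$ (partial bijections, including the empty map) under composition of partial functions; $s^{-1}$ denotes the inverse partial bijection. The input is $n$ together with $a$ and $b$ given explicitly by their action on $[n]$; polynomial time means polynomial in the input size. The relations, for $S=I_n$, are: - $a\sim_i b$ iff there is $s\in S$ with $sas^{-1}=b$ and $s^{-1}bs=a$. - $a\sim_p b$ iff there are $u,v\in S$ with $a=uv$ and $b=vu$. - $\sim_{p^*}$ is the transitive closure of $\sim_p$. - $a\sim_{tr} b$ iff there are $g,h\in S$ that are mutually inverse ($ghg=g$ and $hgh=h$) with $hg=a^\omega$, $gh=b^\omega$ and $ga^{\omega+1}h=b^{\omega+1}$, where $\omega\geq 1$ is an integer such that $s^\omega$ is idempotent for every $s\in S$. *)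

(* Defs.v *)
From HB Require Import structures.
From Stdlib Require Import Relation_Operators.
From mathcomp Require Import all_boot.

Set Implicit Arguments.
Unset Strict Implicit.
Unset Printing Implicit Defensive.

Local Open Scope group_scope.

(* 'I_n = {0, .., n-1} stands for [n]; [None] means "undefined", so that an   *)
(* injective partial function is the same as a bijection between two subsets. *)
Definition pinjective n (f : {ffun 'I_n -> option 'I_n}) : bool :=
  [forall x, forall y, (f x == f y) && (f x != None) ==> (x == y)].

Record pbij (n : nat) := PBij {
  pfun :> {ffun 'I_n -> option 'I_n};
  pfun_inj : pinjective pfun
}.

HB.instance Definition _ n := [isSub for @pfun n].
HB.instance Definition _ n := [Finite of pbij n by <:].

Lemma pinjectiveP n (f : {ffun 'I_n -> option 'I_n}) :
  reflect (forall x y z, f x = Some z -> f y = Some z -> x = y) (pinjective f).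
Proof.
apply: (iffP forallP) => [finj x y z fx fy|finj x].
  by apply/eqP; have /forallP/(_ y) := finj x; rewrite fx fy eqxx.
apply/forallP => y; apply/implyP => /andP[/eqP fxy].
by case fx: (f x) => [z|//] _; apply/eqP/(finj _ _ z) => //; rewrite -fxy.
Qed.

Section PartialBijections.
Variable n : nat.
Implicit Types s t : pbij n.

Definition pb_one_fun : {ffun 'I_n -> option 'I_n} := [ffun x => Some x].

(* (s * t)(x) = s (t x) *)
Definition pb_mul_fun s t : {ffun 'I_n -> option 'I_n} :=
  [ffun x => obind s (t x)].

Definition pb_inv_fun s : {ffun 'I_n -> option 'I_n} :=
  [ffun y => [pick x | s x == Some y]].

Lemma pbijP s x y z : s x = Some z -> s y = Some z -> x = y.
Proof. exact: (pinjectiveP _ (pfun_inj s)). Qed.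

Lemma pb_inv_funE s x y : (pb_inv_fun s y = Some x) <-> (s x = Some y).
Proof.
rewrite ffunE; case: pickP => [z /eqP sz|no]; split.
- by case=> <-.
- by move=> sx; rewrite (pbijP sz sx).
- by [].
- by move=> sx; have := no x; rewrite sx eqxx.
Qed.

Lemma pb_one_inj : pinjective pb_one_fun.
Proof. by apply/pinjectiveP => x y z; rewrite !ffunE => -[->] [->]. Qed.

Lemma pb_mul_inj s t : pinjective (pb_mul_fun s t).
Proof.
apply/pinjectiveP => x y z; rewrite !ffunE.
case tx: (t x) => [u|//]; case ty: (t y) => [v|//] /= su sv.
by apply: (pbijP tx); rewrite (pbijP su sv).
Qed.

Lemma pb_inv_inj s : pinjective (pb_inv_fun s).
Proof.
apply/pinjectiveP => x y z /pb_inv_funE sx /pb_inv_funE sy.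
by apply: Some_inj; rewrite -sx -sy.
Qed.

Definition pb_one : pbij n := PBij pb_one_inj.
Definition pb_mul s t : pbij n := PBij (pb_mul_inj s t).
Definition pb_inv s : pbij n := PBij (pb_inv_inj s).

Lemma pbij_ext s t : (forall x y, s x = Some y <-> t x = Some y) -> s = t.
Proof.
move=> st; apply/val_inj/ffunP => x; case sx: (s x) => [y|].
  by apply/esym/st.
by case tx: (t x) => [y|//]; have/st := tx; rewrite sx.
Qed.

Lemma pb_mulE s t x z :
  (pb_mul s t x = Some z) <-> exists2 y, t x = Some y & s y = Some z.
Proof.
rewrite ffunE; case: (t x) => [y|] /=; split=> //.
- by exists y.
- by case=> _ [<-].
- by case.
Qed.

Lemma pb_mulA : associative pb_mul.
Proof.
by move=> r s t; apply/val_inj/ffunP => x; rewrite !ffunE /=;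
  case: (t x) => //= y; rewrite ffunE.
Qed.

Lemma pb_mul1 : left_id pb_one pb_mul.
Proof.
by move=> s; apply/val_inj/ffunP => x; rewrite !ffunE /=;
  case: (s x) => //= y; rewrite ffunE.
Qed.

Lemma pb_invK : involutive pb_inv.
Proof.
move=> s; apply: pbij_ext => x y.
by split=> [/pb_inv_funE/pb_inv_funE|sx] //; apply/pb_inv_funE/pb_inv_funE.
Qed.

Lemma pb_invM : {morph pb_inv : s t / pb_mul s t >-> pb_mul t s}.
Proof.
move=> s t; apply: pbij_ext => z x; split.
  by move=> /pb_inv_funE/pb_mulE[y tx sy]; apply/pb_mulE;
    exists y; apply/pb_inv_funE.
by move=> /pb_mulE[y /pb_inv_funE sy /pb_inv_funE tx];
  apply/pb_inv_funE/pb_mulE; exists y.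
Qed.

End PartialBijections.

HB.instance Definition _ n :=
  isStarMonoid.Build (pbij n) (@pb_mulA n) (@pb_mul1 n) (@pb_invK n) (@pb_invM n).

Definition sim_i n (a b : pbij n) : Prop :=
  exists s : pbij n, s * a * s^-1 = b /\ s^-1 * b * s = a.

Definition sim_p n (a b : pbij n) : Prop :=
  exists u v : pbij n, a = u * v /\ b = v * u.

Definition sim_pstar n : pbij n -> pbij n -> Prop :=
  clos_trans (pbij n) (@sim_p n).

Definition is_omega n (w : nat) : Prop :=
  (0 < w)%N /\ forall s : pbij n, s ^+ w * s ^+ w = s ^+ w.

(* The powers s ^+ w and s ^+ w.+1 do not depend on the choice of w, and such *)
(* a w exists by [omega_exists].                                              *)
Definition sim_tr n (a b : pbij n) : Prop :=
  exists2 w, is_omega n w &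
  exists g h : pbij n,
    [/\ g * h * g = g /\ h * g * h = h,
        h * g = a ^+ w, g * h = b ^+ w &
        g * a ^+ w.+1 * h = b ^+ w.+1].

Lemma omega_exists n : exists w, is_omega n w.
Proof.
pose m := #|{: pbij n}|; exists m`!; split=> [|s]; first exact: fact_gt0.
have [i [j [ltij lejm eqij]]] :
    exists i j, [/\ (i < j)%N, (j <= m)%N & s ^+ i = s ^+ j].
  have /injectivePn[i [j neij eqij]] : ~~ injectiveb (fun i : 'I_m.+1 => s ^+ i).
    by apply/negP => /injectiveP/leq_card; rewrite card_ord ltnn.
  case: (ltngtP i j) => [ltij|ltji|/val_inj eq]; last by rewrite eq eqxx in neij.
  - by exists i, j; split=> //; rewrite -ltnS.
  - by exists j, i; split=> //; rewrite -ltnS.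
have per k q : (i <= k)%N -> s ^+ (k + q * (j - i)) = s ^+ k.
  move=> leik; elim: q => [|q IHq]; first by rewrite addn0.
  rewrite -[in RHS]IHq mulSn -(subnK leik) -!addnA expgnDr [in RHS]expgnDr.
  by rewrite addnA subnKC ?(ltnW ltij) // !(expgnDr _ _ (q * _)) eqij.
have d0 : (0 < j - i)%N by rewrite subn_gt0.
have dvd : (j - i %| m`!)%N.
  by rewrite dvdn_fact // d0 (leq_trans (leq_subr _ _)).
have lei : (i <= m`!)%N.
  apply: leq_trans (ltnW ltij) (leq_trans lejm _); apply: dvdn_leq.
    exact: fact_gt0.
  by rewrite dvdn_fact // leqnn andbT (leq_trans _ lejm) // (leq_ltn_trans _ ltij).
by rewrite -expgnDr -{2}(divnK dvd) per.
Qed.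

(* Structured (while) programs over a register file and an unbounded memory   *)
(* of natural numbers. A program names finitely many registers; the memory is *)
(* addressed indirectly, through [Read] and [Write]; [Sub] is truncated.      *)
Inductive cmd : Type :=
| Skip
| Const of nat & nat
| Add of nat & nat & nat
| Sub of nat & nat & nat
| Read of nat & nat
| Write of nat & nat
| Seq of cmd & cmd
| If of nat & cmd & cmd
| While of nat & cmd.

Record ram := Ram { reg : nat -> nat; mem : nat -> nat }.

Definition set_reg (st : ram) (d v : nat) : ram :=
  Ram [eta reg st with d |-> v] (mem st).

Definition set_mem (st : ram) (x v : nat) : ram :=
  Ram (reg st) [eta mem st with x |-> v].

(* Length of the binary expansion, with [bits 0 = 1]. *)
Definition bits (m : nat) : nat := (trunc_log 2 m).+1.

(* [exec c st t st'] : started in state st, the program c halts in state st'  *)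
(* at cost t. Each elementary step is charged the lengths of its operands,    *)
(* including the addresses used (the Cook-Reckhow logarithmic cost), so that  *)
(* polynomial cost here is polynomial time on a Turing machine.               *)
Inductive exec : cmd -> ram -> nat -> ram -> Prop :=
| ExecSkip st :
    exec Skip st 1 st
| ExecConst d k st :
    exec (Const d k) st (bits k) (set_reg st d k)
| ExecAdd d x y st :
    exec (Add d x y) st (bits (reg st x) + bits (reg st y))
      (set_reg st d (reg st x + reg st y))
| ExecSub d x y st :
    exec (Sub d x y) st (bits (reg st x) + bits (reg st y))
      (set_reg st d (reg st x - reg st y))
| ExecRead d x st :
    exec (Read d x) st (bits (reg st x) + bits (mem st (reg st x)))
      (set_reg st d (mem st (reg st x)))
| ExecWrite x y st :
    exec (Write x y) st (bits (reg st x) + bits (reg st y))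
      (set_mem st (reg st x) (reg st y))
| ExecSeq c1 c2 st1 st2 st3 t1 t2 :
    exec c1 st1 t1 st2 -> exec c2 st2 t2 st3 ->
    exec (Seq c1 c2) st1 (t1 + t2) st3
| ExecIfT x c1 c2 st st' t :
    reg st x != 0%N -> exec c1 st t st' ->
    exec (If x c1 c2) st (bits (reg st x) + t) st'
| ExecIfF x c1 c2 st st' t :
    reg st x = 0%N -> exec c2 st t st' ->
    exec (If x c1 c2) st (bits (reg st x) + t) st'
| ExecWhileT x c st1 st2 st3 t1 t2 :
    reg st1 x != 0%N -> exec c st1 t1 st2 -> exec (While x c) st2 t2 st3 ->
    exec (While x c) st1 (bits (reg st1 x) + t1 + t2) st3
| ExecWhileF x c st :
    reg st x = 0%N -> exec (While x c) st (bits (reg st x)) st.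

Lemma exec_det c st t1 st1 t2 st2 :
  exec c st t1 st1 -> exec c st t2 st2 -> t1 = t2 /\ st1 = st2.
Proof.
move=> ex1; elim: ex1 t2 st2 => {c st t1 st1}; intros;
  match goal with
  | H : exec (_ _) _ _ _ |- _ => inversion H
  | H : exec Skip _ _ _ |- _ => inversion H
  end; subst; try by [];
  repeat match goal with
  | IH : (forall t s, exec ?c ?s0 t s -> _), H : exec ?c ?s0 _ _ |- _ =>
      have [? ?] := IH _ _ H; clear IH; subst
  end; try by [];
  match goal with
  | H : is_true (_ != _), K : _ = 0%N |- _ => by rewrite K eqxx in H
  end.
Qed.

(* The input is placed in mem[0], mem[1], ..; all other cells and all         *)
(* registers are initially 0.                                                 *)
Definition init (input : seq nat) : ram := Ram (fun=> 0%N) (nth 0%N input).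

Definition input_size (input : seq nat) : nat := (\sum_(m <- input) bits m)%N.

Definition encode_value n (o : option 'I_n) : nat :=
  if o is Some j then j.+1 else 0%N.

Definition encode_pbij n (a : pbij n) : seq nat :=
  [seq encode_value (a i) | i <- enum 'I_n].

Definition encode_input n (a b : pbij n) : seq nat :=
  n :: encode_pbij a ++ encode_pbij b.

(* One program serves all n; its answer, 0 or 1, is left in register 0. *)
Definition ptime_decidable (R : forall n, pbij n -> pbij n -> Prop) : Prop :=
  exists (c : cmd) (C k : nat), forall n (a b : pbij n),
  exists (t : nat) (st : ram) (ans : bool),
    [/\ exec c (init (encode_input a b)) t st,
        (t <= C * input_size (encode_input a b) ^ k)%N,
        reg st 0 = ans :> nat &
        ans <-> R n a b].

(* Main.v *)
Require Import Defs.
From Stdlib Require Import Relation_Operators.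
From mathcomp Require Import all_boot zify.

Set Implicit Arguments.
Unset Strict Implicit.
Unset Printing Implicit Defensive.

(* A partial bijection of [n] is a disjoint union of cycles and maximal       *)
(* chains. Both ~p* and ~tr amount to having the same number of cycles of     *)
(* each length: a is joined to a^(w+1), its restriction to the cyclic points, *)
(* by restricting it successively to the images of a, a^2, ... For ~i the     *)
(* chain lengths must agree too. Finally a = uv, b = vu describes a bipartite *)
(* graph on two copies of [n] whose components alternate between the copies,  *)
(* so a ~p b means that, besides equal cycle types, the chains sorted by      *)
(* length differ pairwise by at most one (absent chains having length 0).     *)
(* The cycle type is determined by the numbers of fixed points of a^k, and    *)
(* the chain lengths by the numbers c_k of points from which exactly k steps  *)
(* are possible, which also count the chains of more than k points; the last  *)
(* condition is c_(k+1)(a) <= c_k(b) and c_(k+1)(b) <= c_k(a). Only k <= n is *)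
(* needed, and all these numbers are found by iterating a and b.              *)

(** * Cycles of injective maps *)

(** Each relation is decided by comparing polynomially many counts. If [a = u * v] and [b = v * u],
    then [u] and [v] carry the fixed points of [a ^+ k] and of [b ^+ k] injectively into one another
    ([card_fixpts_swap]). Conversely, equal fixed-point numbers give equal numbers of cycles of each
    length ([order_counts]), and matching cycles conjugates the cyclic part of [a] to that of [b]
    ([cyclic_conj]). This settles ~p* and ~tr ([sim_pstarP], [sim_trP]): noncyclic points can be
    stripped off by ~p-steps, and ~tr ignores them.

    For ~p and ~i the chains matter too. [level_swap] bounds the chain counts of [u * v] by those of
    [v * u]; conversely, [chain_coordsP] sorts the chains by length and [interlaced_factor] builds
    [u] and [v] row by row ([sim_pP]). If the lengths agree, [u] is a permutation, whence ~i
    ([sim_iP]).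

    A single loop program, with a test depending on the relation, finds the counts by iterating [a]
    and [b] from every point ([runs_main]). Its cost is of order n^4 even if numbers are charged in
    unary. *)

Lemma level_matching (T : finType) (A B : {set T}) (lA lB : T -> nat) :
    (forall v, #|[set x in A | lA x == v]| = #|[set y in B | lB y == v]|) ->
  exists2 p : T -> T, {in A, forall x, p x \in B /\ lB (p x) = lA x} &
    {in A &, injective p}.
Proof.
move=> eqAB; pose LA v := [set x in A | lA x == v].
pose LB v := [set y in B | lB y == v].
(* Within a level, the i-th element of [A] goes to the i-th element of [B]; for [x] in [A] the
   default of [nth] is not reached, both level sets having the same size. *)
pose p x := nth x (enum (LB (lA x))) (index x (enum (LA (lA x)))).
have idx x : x \in A -> index x (enum (LA (lA x))) < size (enum (LB (lA x))).
  move=> xA; rewrite -cardE -eqAB cardE index_mem mem_enum inE xA eqxx //.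
have pP x : x \in A -> p x \in LB (lA x).
  by move=> xA; rewrite -mem_enum mem_nth // idx.
exists p => [x /pP|x y xA yA eqp]; first by rewrite inE => /andP[-> /eqP].
have eql : lA x = lA y.
  have := pP _ xA; have := pP _ yA; rewrite -eqp !inE => /andP[_ /eqP <-].
  by case/andP=> _ /eqP.
move: eqp; rewrite /p eql (set_nth_default y) => [/eqP|]; last by rewrite -eql idx.
rewrite nth_uniq ?enum_uniq ?idx // -?eql ?idx // => /eqP /(congr1 (nth x (enum (LA (lA x))))).
by rewrite !nth_index // mem_enum inE ?xA ?yA ?eql eqxx.
Qed.

Lemma iter_modn_order (T : finType) (f : T -> T) k x :
  injective f -> iter k f x = iter (k %% order f x) f x.
Proof.
move=> injf; rewrite {1}(divn_eq k (order f x)) addnC iterD.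
congr (iter _ _ _); elim: (k %/ _) => //= q IHq.
by rewrite mulSn iterD IHq iter_order.
Qed.

Lemma iter_fix_order (T : finType) (f : T -> T) k x :
  injective f -> (iter k f x == x) = (order f x %| k).
Proof.
move=> injf; have lt := ltn_pmod k (order_gt0 f x).
rewrite (iter_modn_order k x injf) /dvdn.
apply/eqP/eqP => [fx|-> //].
by have := findex_iter lt; rewrite fx findex0.
Qed.

(** [iter v f] fixes exactly the points whose order divides [v]. Strong induction removes the proper
    divisors, and no order exceeds [#|T|]. *)
Lemma order_counts (T : finType) (f g : T -> T) (A B : {set T}) :
    injective f -> injective g ->
    (forall k, 0 < k <= #|T| ->
       #|[set x in A | iter k f x == x]| = #|[set y in B | iter k g y == y]|) ->
  forall v, #|[set x in A | order f x == v]| = #|[set y in B | order g y == v]|.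
Proof.
move=> injf injg eqfg; elim/ltn_ind => v IHv.
case: (posnP v) => [->|v0].
  rewrite !eq_card0 // => x; rewrite !inE.
    by rewrite (gtn_eqF (order_gt0 g x)) andbF.
  by rewrite (gtn_eqF (order_gt0 f x)) andbF.
case: (leqP v #|T|) => [vT|vT]; last first.
  rewrite !eq_card0 // => x; rewrite !inE ltn_eqF ?andbF //;
    by apply: leq_ltn_trans vT; apply: max_card.
have E (h : T -> T) (C : {set T}) : injective h ->
    #|[set x in C | iter v h x == x]| = #|[set x in C | order h x == v]| +
      \sum_(d < v | d %| v) #|[set x in C | order h x == d]|.
  move=> injh; rewrite -sum1_card.
  rewrite (partition_big (fun x => inord (order h x) : 'I_v.+1)
             (fun d : 'I_v.+1 => d %| v)) => [|x]; last first.
    rewrite inE iter_fix_order // => /andP[_ dv].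
    by rewrite inordK // ltnS dvdn_leq.
  rewrite big_mkcond big_ord_recr /= dvdnn addnC; congr (_ + _).
    rewrite -sum1_card; apply: eq_bigl => x; rewrite !inE iter_fix_order // -val_eqE /=.
    case ov: (order h x %| v); first by rewrite andbT inordK // ltnS dvdn_leq.
    by case: (order h x =P v) ov => [->|]; rewrite ?dvdnn ?andbF.
  rewrite [RHS]big_mkcond; apply: eq_bigr => d _; case: ifP => // dv.
  rewrite -sum1_card; apply: eq_bigl => x; rewrite !inE iter_fix_order // -val_eqE /=.
  case ov: (order h x %| v); first by rewrite andbT inordK // ltnS dvdn_leq.
  by case: (order h x =P d) ov => [->|]; rewrite ?dv ?andbF.
have := eqfg v; rewrite v0 vT => /(_ isT).
rewrite !E // => /eqP; rewrite (eq_bigr (fun d : 'I_v => #|[set y in B | order g y == d]|)).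
  by rewrite eqn_add2r => /eqP.
by move=> d _; apply: IHv.
Qed.

Lemma fclosed_froot (T : finType) (f : T -> T) (A : {set T}) x :
  injective f -> {homo f : x / x \in A} -> (froot f x \in A) = (x \in A).
Proof.
move=> injf fA; apply/esym.
apply: (@closed_connect _ _ (mem A)); last exact: connect_root.
apply: intro_closed => [|y z /eqP <-]; [exact: fconnect_sym | exact: fA].
Qed.

(** A cycle of length [v] has [v] points and one root, so counts of points become counts of
    cycles. *)
Lemma root_counts (T : finType) (f : T -> T) (A : {set T}) v :
    injective f -> {homo f : x / x \in A} ->
  #|[set x in A | order f x == v]| =
    #|[set x in [set x in A | froot f x == x] | order f x == v]| * v.
Proof.
move=> injf fA.
rewrite -(@fcard_order_set _ _ injf v); first last.
- apply: intro_closed => [|y z /eqP <-]; first exact: fconnect_sym.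
  rewrite !inE => /andP[/fA -> /eqP <-]; apply/eqP.
  by apply: eq_card => t; rewrite !inE -same_fconnect1.
- by apply/subsetP => x; rewrite !inE => /andP[_].
congr (_ * _); apply: eq_card => x; rewrite !inE /roots.
by rewrite andbC andbAC -andbA andbC.
Qed.

(** Roots are matched with roots of cycles of the same length, and the point [i] steps after a root
    goes to the point [i] steps after its partner. Equal lengths make this commute where the cycle
    closes up. *)
Lemma cycle_embedding (T : finType) (f g : T -> T) (A B : {set T}) :
    injective f -> injective g ->
    {homo f : x / x \in A} -> {homo g : x / x \in B} ->
    (forall k, 0 < k <= #|T| ->
       #|[set x in A | iter k f x == x]| = #|[set y in B | iter k g y == y]|) ->
  exists h : T -> T, [/\ {in A, forall x, h x \in B}, {in A &, injective h} &
    {in A, forall x, h (f x) = g (h x)}].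
Proof.
move=> injf injg fA gB eqfg.
pose RA := [set x in A | froot f x == x]; pose RB := [set x in B | froot g x == x].
have [|p pP injp] := @level_matching T RA RB (order f) (order g).
  move=> v; case: (posnP v) => [->|v0].
    rewrite !eq_card0 // => x; rewrite !inE.
      by rewrite (gtn_eqF (order_gt0 g x)) andbF.
    by rewrite (gtn_eqF (order_gt0 f x)) andbF.
  have := order_counts injf injg eqfg v; 
  rewrite (root_counts v injf fA) (root_counts v injg gB).
  by move=> /eqP; rewrite eqn_pmul2r // => /eqP.
have rA x : x \in A -> froot f x \in RA.
  by move=> xA; rewrite inE fclosed_froot // xA (root_root (fconnect_sym injf)) eqxx.
pose h x := iter (findex f (froot f x) x) g (p (froot f x)).
have iterB k y : y \in B -> iter k g y \in B by move=> yB; elim: k => //= k; apply: gB.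
have pB x : x \in A -> [/\ p (froot f x) \in B, froot g (p (froot f x)) = p (froot f x)
    & order g (p (froot f x)) = order f (froot f x)].
  by move=> xA; have [] := pP _ (rA x xA); rewrite inE => /andP[-> /eqP ->].
have findexK x : iter (findex f (froot f x) x) f (froot f x) = x.
  by apply: iter_findex; rewrite fconnect_sym // connect_root.
have root_iter k y : froot g (iter k g y) = froot g y.
  apply/eqP; rewrite (root_connect (fconnect_sym injg)) (fconnect_sym injg).
  exact: fconnect_iter.
have findexlt x : findex f (froot f x) x < order f (froot f x).
  by apply: findex_max; rewrite fconnect_sym // connect_root.
exists h; split=> [x xA|x y xA yA|x xA].
- by have [pB1 _ _] := pB x xA; apply: iterB.
- have [_ rx ox] := pB x xA; have [_ ry oy] := pB y yA => hxy.
  have eqr : froot f x = froot f y.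
    apply: injp; rewrite ?rA // -rx -ry.
    by rewrite -(root_iter (findex f (froot f x) x)) -/(h x) hxy root_iter.
  rewrite -(findexK x) -(findexK y) eqr; congr (iter _ _ _).
  have ltx := findexlt x; have lty := findexlt y.
  rewrite -ox in ltx; rewrite -oy in lty; rewrite -eqr in lty *.
  by rewrite -(findex_iter ltx) -(findex_iter lty) -/(h x) hxy /h eqr.
have [_ _ ox] := pB x xA.
have eqr : froot f (f x) = froot f x.
  apply/eqP; rewrite (root_connect (fconnect_sym injf)) (fconnect_sym injf).
  exact: fconnect1.
have lt1 := findexlt (f x).
have fx := findexK (f x).
rewrite /h eqr in lt1 fx *.
rewrite -iterS; set j := findex _ _ (f x) in lt1 fx *; set i := findex _ _ x.
have : iter i.+1 f (froot f x) = iter j f (froot f x) by rewrite fx iterS findexK.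
rewrite (iter_modn_order i.+1) // => eqij.
have lt2 : i.+1 %% order f (froot f x) < order f (froot f x) by rewrite ltn_mod order_gt0.
have -> : j = i.+1 %% order f (froot f x).
  by rewrite -(findex_iter lt1) -eqij findex_iter.
by rewrite [RHS]iter_modn_order // ox.
Qed.

(** * Conjugacy of partial bijections *)

Local Open Scope group_scope.

Lemma pmulE n (s t : pbij n) x : (s * t) x = obind s (t x).
Proof. by rewrite ffunE. Qed.

Lemma poneE n x : (1 : pbij n) x = Some x.
Proof. by rewrite ffunE. Qed.

Lemma pinvP n (s : pbij n) x y : (s^-1 y = Some x) <-> (s x = Some y).
Proof. exact: pb_inv_funE. Qed.

Lemma pinv_id n (s : pbij n) x y : s x = Some y -> s^-1 y = Some x.
Proof. by move/pinvP. Qed.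

Lemma pexpDE n (a : pbij n) j k x : (a ^+ (j + k)) x = obind (a ^+ j) ((a ^+ k) x).
Proof. by rewrite expgnDr pmulE. Qed.

Lemma pexpSE n (a : pbij n) k x : (a ^+ k.+1) x = obind a ((a ^+ k) x).
Proof. by rewrite expgS pmulE. Qed.

Lemma pexpSEr n (a : pbij n) k x : (a ^+ k.+1) x = obind (a ^+ k) (a x).
Proof. by rewrite -addn1 pexpDE expg1. Qed.

Lemma pbij_of_rel n (R : 'I_n -> 'I_n -> bool) :
    (forall x y z, R x y -> R x z -> y = z) ->
    (forall x y z, R x z -> R y z -> x = y) ->
  exists s : pbij n, forall x y, (s x = Some y) <-> R x y.
Proof.
move=> Rfun Rinj; pose f := [ffun x => [pick y | R x y]].
have fP x y : (f x = Some y) <-> R x y.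
  rewrite ffunE; case: pickP => [z Rxz|R0]; split=> //.
  - by case=> <-.
  - by move=> Rxy; rewrite (Rfun _ _ _ Rxy Rxz).
  - by rewrite R0.
have finj : pinjective f.
  by apply/pinjectiveP => x y z /fP Rxz /fP Ryz; apply: Rinj Rxz Ryz.
by exists (PBij finj).
Qed.

Definition fixpts n (a : pbij n) k := [set x | (a ^+ k) x == Some x].

(* The points from which exactly [k] steps are possible: each maximal chain   *)
(* with more than [k] points contains exactly one of them.                    *)
Definition level n (a : pbij n) k :=
  [set x | ((a ^+ k) x != None) && ((a ^+ k.+1) x == None)].

(** * The cyclic points of a partial bijection *)

Section Cyclic.
Variables (n w : nat).
Hypothesis omega_w : is_omega n w.
Implicit Types a b : pbij n.

Lemma omega_gt0 : 0 < w. Proof. by case: omega_w. Qed.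

Lemma omega_idem a : a ^+ w * a ^+ w = a ^+ w.
Proof. by case: omega_w. Qed.

Lemma idem_id (e : pbij n) x y : e * e = e -> e x = Some y -> y = x.
Proof.
move=> ee ex; apply: (@pbijP _ e _ _ y) => //.
by have := ex; rewrite -{1}ee pmulE ex.
Qed.

Lemma omega_id a x y : (a ^+ w) x = Some y -> (a ^+ w) x = Some x.
Proof. by move=> ex; rewrite {2}(esym (idem_id (omega_idem a) ex)). Qed.

Lemma fixpts_omega a x : (x \in fixpts a w) = ((a ^+ w) x != None).
Proof. by rewrite inE; case ex: ((a ^+ w) x) => [y|//]; rewrite -ex (omega_id ex) eqxx. Qed.

Lemma omega_mulr a k : a ^+ (k.+1 * w) = a ^+ w.
Proof.
elim: k => [|k IHk]; first by rewrite mul1n.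
by rewrite mulSn expgnDr IHk omega_idem.
Qed.

Lemma fixpts_sub a k x : 0 < k -> x \in fixpts a k -> x \in fixpts a w.
Proof.
case: k => // k _; rewrite !inE => /eqP fx.
rewrite -(omega_mulr a k) mulnC; apply/eqP.
elim: w => [|m IHm]; first by rewrite poneE.
by rewrite mulSn pexpDE IHm.
Qed.

Lemma omega_step a x : x \in fixpts a w ->
  exists2 y, a x = Some y & y \in fixpts a w.
Proof.
rewrite inE => /eqP ex; case ax: (a x) => [y|]; last first.
  by have := ex; rewrite -(prednK omega_gt0) pexpSEr ax.
exists y => //; rewrite inE; apply/eqP.
by have := pexpSEr a w x; rewrite ax /= => <-; rewrite pexpSE ex.
Qed.

Lemma omega_defined a k x : x \in fixpts a w -> (a ^+ k) x != None.
Proof.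
elim: k x => [|k IHk] x; first by rewrite poneE.
by case/omega_step=> y ax /IHk; rewrite pexpSEr ax.
Qed.

Lemma omega_ge a k x : w <= k -> (a ^+ k) x != None -> x \in fixpts a w.
Proof.
move=> lewk; rewrite fixpts_omega -{1}(subnK lewk) pexpDE.
by case: ((a ^+ w) x).
Qed.

(** A total injective extension of the cyclic part, to which the lemmas on cycles apply: [a ^+ w.+1]
    is defined at the cyclic points only and agrees with [a] there; all other points become
    fixed. *)
Definition cyc_fun a x := odflt x ((a ^+ w.+1) x).

Lemma cyc_funE a x : x \in fixpts a w -> a x = Some (cyc_fun a x).
Proof.
move=> xA; rewrite /cyc_fun pexpSE; move: (xA); rewrite inE => /eqP -> /=.
by have [y ->] := omega_step xA.
Qed.

Lemma cyc_fun_id a x : x \notin fixpts a w -> cyc_fun a x = x.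
Proof. by rewrite fixpts_omega /cyc_fun pexpSE; case: ((a ^+ w) x). Qed.

Lemma cyc_fun_in a : {homo cyc_fun a : x / x \in fixpts a w}.
Proof. by move=> x xA; have [y] := omega_step xA; rewrite cyc_funE // => -[->]. Qed.

Lemma cyc_fun_inj a : injective (cyc_fun a).
Proof.
move=> x y; case xA: (x \in fixpts a w); case yA: (y \in fixpts a w).
- move=> exy; apply: (@pbijP _ a _ _ (cyc_fun a y)); first by rewrite -exy cyc_funE.
  exact: cyc_funE.
- by rewrite (cyc_fun_id (negbT yA)) => exy; rewrite -exy cyc_fun_in in yA.
- by rewrite (cyc_fun_id (negbT xA)) => exy; rewrite exy cyc_fun_in in xA.
- by rewrite !cyc_fun_id ?xA ?yA.
Qed.

Lemma cyc_fun_iter a k x : x \in fixpts a w -> (a ^+ k) x = Some (iter k (cyc_fun a) x).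
Proof.
move=> xA; elim: k => [|k IHk]; first by rewrite poneE.
rewrite pexpSE IHk /= cyc_funE //; elim: k {IHk} => //= k; exact: cyc_fun_in.
Qed.

Lemma fixpts_cyc_fun a k : 0 < k ->
  fixpts a k = [set x in fixpts a w | iter k (cyc_fun a) x == x].
Proof.
move=> k0; apply/setP => x; rewrite [RHS]inE; apply/idP/andP => [xk|[xA /eqP fx]].
  have xA := fixpts_sub k0 xk; split=> //.
  by move: xk; rewrite inE cyc_fun_iter.
by rewrite inE cyc_fun_iter // fx.
Qed.

Lemma cyclic_conj a b :
    (forall k, 0 < k <= n -> #|fixpts a k| = #|fixpts b k|) ->
  exists g : pbij n, [/\ g^-1 * g = a ^+ w, g * g^-1 = b ^+ w & g * a ^+ w.+1 = b ^+ w.+1 * g].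
Proof.
move=> eqab; pose A := fixpts a w; pose B := fixpts b w.
have eqAB k : 0 < k <= #|'I_n| -> #|[set x in A | iter k (cyc_fun a) x == x]|
    = #|[set x in B | iter k (cyc_fun b) x == x]|.
  by rewrite card_ord => /[dup] /eqab + /andP[k0 _]; rewrite -!fixpts_cyc_fun.
have [h [hB injh hf]] := cycle_embedding (@cyc_fun_inj a) (@cyc_fun_inj b)
  (@cyc_fun_in a) (@cyc_fun_in b) eqAB.
(* Embeddings both ways give [#|A| = #|B|], so [h] maps onto [B]. *)
have [h' [h'A injh' _]] := cycle_embedding (@cyc_fun_inj b) (@cyc_fun_inj a)
  (@cyc_fun_in b) (@cyc_fun_in a) (fun k Hk => esym (eqAB k Hk)).
have imh : h @: A = B.
  apply/eqP; rewrite eqEcard; apply/andP; split.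
    by apply/subsetP => _ /imsetP[x /hB xB ->].
  rewrite (card_in_imset injh) -(card_in_imset injh'); apply: subset_leq_card.
  by apply/subsetP => _ /imsetP[x /h'A xA ->].
have [|x y z|g gP] := @pbij_of_rel n (fun x y => (x \in A) && (h x == y)).
- by move=> x y z /andP[_ /eqP <-] /andP[_ /eqP].
- by move=> /andP[xA /eqP <-] /andP[yA /eqP /injh]; move/(_ yA xA).
have gA x : x \in A -> g x = Some (h x) by move=> xA; apply/gP; rewrite xA eqxx.
have gN x : x \notin A -> g x = None.
  by move=> xA; case gx: (g x) => [y|//]; move/gP: gx; rewrite (negPf xA).
exists g; split.
- apply/val_inj/ffunP => x; rewrite pmulE.
  case xA: (x \in A).
    rewrite (gA _ xA) /= (pinv_id (gA _ xA)).
    by move: xA; rewrite inE => /eqP ->.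
  by rewrite (gN _ (negbT xA)) /=; move: xA; rewrite fixpts_omega; case: (_ x).
- apply/val_inj/ffunP => y; rewrite pmulE.
  case yB: (y \in B).
    move: (yB); rewrite -imh => /imsetP[x xA exy].
    have gx := gA _ xA; rewrite -exy in gx.
    by rewrite (pinv_id gx) /= gx; move: yB; rewrite inE => /eqP ->.
  have -> : (b ^+ w) y = None by move: yB; rewrite fixpts_omega; case: (_ y).
  case gy: (g^-1 y) => [x|//]; move/pinvP/gP: gy => /andP[xA /eqP exy].
  by rewrite -exy hB in yB.
apply/val_inj/ffunP => x; rewrite !pmulE.
case xA: (x \in A).
  have fxA k : iter k (cyc_fun a) x \in A by elim: k => //= k; apply: cyc_fun_in.
  rewrite (cyc_fun_iter _ xA) (gA _ xA) [LHS](gA _ (fxA _)) [RHS](cyc_fun_iter _ (hB _ xA)).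
  by congr Some; elim: w.+1 => //= k <-; rewrite hf.
rewrite (gN _ (negbT xA)) pexpSE /=.
by move: xA; rewrite fixpts_omega; case: (_ x).
Qed.

End Cyclic.

(** * Cycle types and the relations ~p* and ~tr *)

Definition same_cycles n (a b : pbij n) :=
  forall k, 0 < k <= n -> #|fixpts a k| = #|fixpts b k|.

Lemma expg_swap n (u v : pbij n) k : v * (u * v) ^+ k = (v * u) ^+ k * v.
Proof.
elim: k => [|k IHk]; first by rewrite mulg1 mul1g.
by rewrite !expgS !mulgA -(mulgA _ v) IHk !mulgA.
Qed.

Lemma leq_card_pbij n (s : pbij n) (A B : {set 'I_n}) :
  (forall x, x \in A -> exists2 y, s x = Some y & y \in B) -> #|A| <= #|B|.
Proof.
move=> sAB; pose f x := odflt x (s x).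
have fA x : x \in A -> s x = Some (f x) /\ f x \in B.
  by move=> /sAB[y sx yB]; rewrite /f sx.
rewrite -(@card_in_imset _ _ f A); last first.
  move=> x y /fA[sx _] /fA[sy _] exy; apply: (pbijP sx); by rewrite exy.
by apply/subset_leq_card/subsetP => _ /imsetP[x /fA[_ fx] ->].
Qed.

Lemma card_fixpts_swap n (u v : pbij n) k :
  0 < k -> #|fixpts (u * v) k| <= #|fixpts (v * u) k|.
Proof.
case: k => // k _; apply: (@leq_card_pbij _ v) => x.
rewrite inE => /eqP fx.
have [y vx] : exists y, v x = Some y.
  by move: fx; rewrite pexpSEr pmulE; case: (v x) => // y; exists y.
exists y => //; rewrite inE; apply/eqP.
have := congr1 (fun s : pbij n => s x) (expg_swap u v k.+1).
by rewrite /= (pmulE v) (pmulE _ v) fx vx /= => <-.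
Qed.

Lemma sim_p_fixpts n (a b : pbij n) k :
  0 < k -> sim_p a b -> #|fixpts a k| = #|fixpts b k|.
Proof.
move=> k0 [u [v [-> ->]]]; apply/eqP.
by rewrite eqn_leq !card_fixpts_swap.
Qed.

Lemma sim_pstar_fixpts n (a b : pbij n) k :
  0 < k -> sim_pstar a b -> #|fixpts a k| = #|fixpts b k|.
Proof.
move=> k0; elim=> {a b} [a b|a c b _ -> _ ->] //; exact: sim_p_fixpts.
Qed.

(** The power [k] of [a ^+ w.+1] is [a ^+ k * a ^+ w], and [a ^+ w] is the identity on the cyclic
    points, among which all fixed points of [a ^+ k] lie. *)
Lemma fixpts_omegaS n w (a : pbij n) k :
  is_omega n w -> 0 < k -> fixpts (a ^+ w.+1) k = fixpts a k.
Proof.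
move=> ow; case: k => // k _.
have e : (a ^+ w.+1) ^+ k.+1 = a ^+ k.+1 * a ^+ w.
  by rewrite -expgnA mulSn expgnDr (mulnC w) omega_mulr.
apply/setP => x; rewrite !inE e pmulE.
apply/eqP/eqP => [fx|fx].
  by case ax: ((a ^+ w) x) fx => [y|//] /=; rewrite (idem_id (omega_idem ow a) ax).
have : x \in fixpts a k.+1 by rewrite inE fx.
by move/(fixpts_sub ow (ltn0Sn k)); rewrite inE => /eqP -> /=.
Qed.

(* Restricting [a] further from the image of [a ^+ k] to the image of         *)
(* [a ^+ k.+1] removes the points with exactly [k] predecessors.              *)
Lemma sim_p_restrict n (a : pbij n) k :
  sim_p (a * (a ^+ k * (a ^+ k)^-1)) (a * (a ^+ k.+1 * (a ^+ k.+1)^-1)).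
Proof.
have [e eE eP] : exists2 e : nat -> pbij n, (forall j, a ^+ j * (a ^+ j)^-1 = e j)
    & forall j y z, (e j y = Some z) <-> y = z /\ exists x, (a ^+ j) x = Some y.
  exists (fun j => a ^+ j * (a ^+ j)^-1) => // j y z; rewrite pmulE; split.
    case ex: ((a ^+ j)^-1 y) => [x|//] /= ax; move/pinvP: ex => ax'.
    by split; [apply: Some_inj; rewrite -ax -ax' | exists x].
  by case=> <- [x ax]; rewrite (pinv_id ax) /= ax.
(* [e j] is the partial identity on the image of [a ^+ j]. One product is [a * e k] because [a]
   sends the image of [a ^+ k] into that of [a ^+ k.+1]; the other is [a * e k.+1] because the
   images shrink. *)
rewrite !eE; exists (e k.+1), (a * e k); split; apply: pbij_ext => y z; rewrite !pmulE.
  case ey: (e k y) => [y'|//] /=; move/eP: ey => [<- [x ax]].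
  split=> [ay|]; first by rewrite ay /=; apply/eP; split=> //; exists x; rewrite pexpSE ax.
  by case ay: (a y) => [y''|//] /= /eP[<-].
split.
  case ey: (e k.+1 y) => [y'|//] /=; move/eP: ey => [<- [x ax]] ay.
  suff ey : e k y = Some y by rewrite ffunE ey.
  by apply/eP; split=> //; move: ax; rewrite pexpSEr; case: (a x) => // x' ax'; exists x'.
case ey: (e k.+1 y) => [y'|//] /=; move/eP: ey => [<- _]; rewrite ffunE.
by case ey: (e k y) => [y''|//] /=; move/eP: ey => [<- _].
Qed.

Lemma sim_p_sym n (a b : pbij n) : sim_p a b -> sim_p b a.
Proof. by case=> u [v [-> ->]]; exists v, u. Qed.

Lemma sim_pstar_sym n (a b : pbij n) : sim_pstar a b -> sim_pstar b a.
Proof.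
elim=> {a b} [a b ab|a c b _ ca _ bc]; first exact/t_step/sim_p_sym.
exact: t_trans bc ca.
Qed.

Lemma idem_pinv n (e : pbij n) : e * e = e -> e^-1 = e.
Proof.
move=> ee; apply: pbij_ext => x y; rewrite pinvP.
by split=> ex; move: (ex); rewrite (idem_id ee ex).
Qed.

(** The restrictions start from [a] itself, as [a ^+ 0 = 1], and stop at [j = w], where idempotency
    turns [a ^+ w * (a ^+ w)^-1] into [a ^+ w]. *)
Lemma sim_pstar_omega n w (a : pbij n) : is_omega n w -> sim_pstar a (a ^+ w.+1).
Proof.
move=> ow; have step j : sim_pstar a (a * (a ^+ j * (a ^+ j)^-1)).
  elim: j => [|j IHj]; last by apply: t_trans IHj (t_step _ _ _ _ (sim_p_restrict a j)).
  apply: t_step; exists a, 1; rewrite !mul1g mulg1; split=> //.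
  by rewrite idem_pinv ?mulg1.
by have := step w; rewrite (idem_pinv (omega_idem ow a)) omega_idem // -expgS.
Qed.

Lemma omegaS_omega n w (a : pbij n) : is_omega n w -> a ^+ w.+1 * a ^+ w = a ^+ w.+1.
Proof. by move=> ow; rewrite expgS -mulgA omega_idem. Qed.

Lemma same_cycles_conj n w (a b : pbij n) : is_omega n w -> same_cycles a b ->
  sim_p (a ^+ w.+1) (b ^+ w.+1).
Proof.
move=> ow /(cyclic_conj ow)[g [g1 g2 g3]].
exists g^-1, (g * a ^+ w.+1); split; last by rewrite g3 -mulgA g2 omegaS_omega.
by rewrite mulgA g1 -expgnDr addnC expgnDr omegaS_omega.
Qed.

Lemma sim_pstarP n (a b : pbij n) : sim_pstar a b <-> same_cycles a b.
Proof.
have [w ow] := omega_exists n; split=> [ab k /andP[k0 _]|ab].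
  exact: sim_pstar_fixpts.
apply: t_trans (sim_pstar_omega a ow) _.
apply: t_trans _ (sim_pstar_sym (sim_pstar_omega b ow)).
exact/t_step/same_cycles_conj.
Qed.

(** The conditions on [g] and [h] make [a ^+ w.+1] and [b ^+ w.+1] the two products of
    [a ^+ w.+1 * h] and [g], hence ~p-related. Conversely, the [g] of [cyclic_conj] and its inverse
    serve. *)
Lemma sim_trP n (a b : pbij n) : sim_tr a b <-> same_cycles a b.
Proof.
split=> [[w ow [g [h [_ hg gh gah]]]] k /andP[k0 _]|ab].
  rewrite -(fixpts_omegaS a ow k0) -(fixpts_omegaS b ow k0).
  apply: sim_p_fixpts => //; exists (a ^+ w.+1 * h), g; split; last by rewrite mulgA.
  by rewrite -mulgA hg omegaS_omega.
have [w ow] := omega_exists n; exists w => //.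
have [g [g1 g2 g3]] := cyclic_conj ow ab.
have inv (s : pbij n) : s * s^-1 * s = s.
  apply/val_inj/ffunP => x; rewrite !pmulE; case sx: (s x) => [y|//] /=.
  by rewrite pmulE (pinv_id sx) /= sx.
exists g, g^-1; split=> //; first by split=> //; have := inv g^-1; rewrite invgK.
by rewrite g3 -mulgA g2 omegaS_omega.
Qed.

(** * Maximal chains sorted by length *)

(** Ranking the points by the number of sets [S k] that contain them, deepest first, makes every
    [S k] an initial segment. It will number the chains by decreasing length. *)
Lemma nested_index (T : finType) (S : nat -> {set T}) N :
    (forall k, S k.+1 \subset S k) -> (forall k, N <= k -> S k = set0) ->
  exists2 r : T -> nat, injective r & forall k x, (r x < #|S k|) = (x \in S k).
Proof.
move=> nestS S0.
have mono j k : j <= k -> S k \subset S j.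
  by move/subnK <-; elim: (k - j) => //= i; apply: subset_trans (nestS _).
pose l x := #|[set k : 'I_N | x \in S k]|.
(* A lexicographic key: the depth [l x], with ties broken by [enum_rank x], which is below
   [#|T|]. *)
pose key x := (l x * #|T| + enum_rank x)%N.
have keyI : injective key.
  move=> x y /(congr1 (fun m => m %% #|T|)).
  rewrite !modnMDl !modn_small ?ltn_ord // => exy.
  exact/enum_rank_inj/val_inj.
have key_lt k x y : x \in S k -> y \notin S k -> key y < key x.
  move=> xS yS; have ltkN : k < N.
    by rewrite ltnNge; apply: contraTN xS => /S0 ->; rewrite inE.
  have : l y < l x.
    apply: proper_card; apply/properP; split.
      apply/subsetP => j; rewrite !inE => yj; case: (leqP j k) => [/mono/subsetP|]; first exact.
      by move=> /ltnW/mono/subsetP/(_ _ yj) => yk; rewrite yk in yS.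
    by exists (Ordinal ltkN); rewrite inE.
  rewrite -(leq_pmul2r (_ : 0 < #|T|)) => [lxy|]; last by apply/card_gt0P; exists x.
  apply: leq_trans (leq_trans lxy (leq_addr _ _)).
  by rewrite /key mulSn [X in _ < X]addnC ltn_add2l.
pose r x := #|[set y | key x < key y]|.
have r_lt x y : key x < key y -> r y < r x.
  move=> lxy; apply: proper_card; apply/properP; split.
    by apply/subsetP => z; rewrite !inE; apply: ltn_trans.
  by exists y; rewrite !inE ?ltnn.
exists r => [x y rxy|k x].
  by case: (ltngtP (key x) (key y)) => [/r_lt|/r_lt|/keyI]; rewrite ?rxy ?ltnn.
case xS: (x \in S k).
  apply: proper_card; apply/properP; split; last by exists x; rewrite // inE ltnn.
  apply/subsetP => y; rewrite inE; apply: contraTT => yS.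
  by rewrite -leqNgt ltnW // (key_lt k).
apply/negbTE; rewrite -leqNgt; apply/subset_leq_card/subsetP => y yS.
by rewrite inE (key_lt k) ?xS.
Qed.

Lemma level_uniq n (a : pbij n) j k x : x \in level a j -> x \in level a k -> j = k.
Proof.
have H i i' : i < i' -> x \in level a i -> x \in level a i' -> false.
  rewrite !inE => lii' /andP[_ /eqP ai] /andP[ai' _].
  by rewrite -(subnK lii') pexpDE ai in ai'.
by move=> xj xk; case: (ltngtP j k) => // [/H|/H]; [move=> /(_ xj xk)|move=> /(_ xk xj)].
Qed.

Lemma level_step n (a : pbij n) k x y : a x = Some y -> (x \in level a k.+1) = (y \in level a k).
Proof. by move=> ax; rewrite !inE !(pexpSEr a _ x) ax. Qed.

Lemma level_step_ex n (a : pbij n) k x :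
  x \in level a k.+1 -> exists2 y, a x = Some y & y \in level a k.
Proof.
move=> xk; have [y ax] : exists y, a x = Some y.
  by move: xk; rewrite inE !(pexpSEr a _ x); case: (a x) => // y; exists y.
by exists y; rewrite -?(level_step _ ax).
Qed.

(** A point of level [k] starts a path of [k.+1] points, distinct because their levels differ; hence
    [k < n]. *)
Lemma level_eq0 n (a : pbij n) k : n <= k -> level a k = set0.
Proof.
move=> lenk; apply/eqP; apply: contraTT lenk => /set0Pn[x xk]; rewrite -ltnNge.
have def j : j <= k -> exists2 y, (a ^+ j) x = Some y & y \in level a (k - j).
  elim: j => [|j IHj] lejk; first by exists x; rewrite ?poneE ?subn0.
  have [y ay] := IHj (ltnW lejk); rewrite -(subnSK lejk) => yk.
  by have [z az zk] := level_step_ex yk; exists z; rewrite ?pexpSE ?ay.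
pose f (j : 'I_k.+1) := odflt x ((a ^+ j) x).
have fI : injective f.
  move=> i j; have [y ay yk] := def i (leq_ord i); have [z az zk] := def j (leq_ord j).
  rewrite /f ay az /= => eyz; rewrite eyz in yk.
  apply/val_inj/eqP; rewrite -(eqn_sub2lE (leq_ord i) (leq_ord j)).
  by apply/eqP; exact: level_uniq yk zk.
by have := leq_card f fI; rewrite !card_ord.
Qed.

Lemma leq_level n (a : pbij n) j k : j <= k -> #|level a k| <= #|level a j|.
Proof.
move/subnK <-; elim: (k - j) => //= i; apply: leq_trans.
apply: (@leq_card_pbij _ a) => x xk.
exact: level_step_ex.
Qed.

(* The noncyclic points of [a] form a Young diagram with one row per maximal  *)
(* chain, the rows sorted by length, on which [a] decreases [ht] by one.      *)
Definition chain_coords n w (a : pbij n) (row ht : 'I_n -> nat) : Prop :=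
  [/\ forall x, x \notin fixpts a w -> row x < #|level a (ht x)|,
      forall i j, i < #|level a j| ->
        exists x, [/\ x \notin fixpts a w, row x = i & ht x = j],
      forall x y, x \notin fixpts a w -> y \notin fixpts a w ->
        row x = row y -> ht x = ht y -> x = y &
      forall x y, x \notin fixpts a w -> (a x = Some y) <->
        [/\ y \notin fixpts a w, row y = row x & ht x = (ht y).+1]].

(** [ht x] is the number of steps possible from [x], and its row is the rank given by [nested_index]
    to the end [e x] of its chain. There [S k] consists of the ends of chains with more than [k]
    points, and [a ^+ k] maps [level a k] bijectively onto it. *)
Lemma chain_coordsP n w (a : pbij n) : is_omega n w ->
  exists row ht, chain_coords w a row ht.
Proof.
move=> ow.
have /fin_all_exists[p pP] x : exists p : nat * 'I_n,
    x \notin fixpts a w -> (a ^+ p.1) x = Some p.2 /\ a p.2 = None.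
  case xA: (x \in fixpts a w); first by exists (0, x).
  have /ex_minnP[[|j] aj minj] : exists k, (a ^+ k) x == None.
    by exists w; move/negbT: xA; rewrite (fixpts_omega ow) negbK.
  - by rewrite poneE in aj.
  - case ay: ((a ^+ j) x) => [y|]; last by have := minj j; rewrite ay ltnn => /(_ isT).
    by exists (j, y) => _; split=> //; apply/eqP; move: aj; rewrite pexpSE ay.
pose ht x := (p x).1; pose e x := (p x).2.
have lev x : x \notin fixpts a w -> x \in level a (ht x).
  by move=> /pP[px ae]; rewrite inE pexpSE px /= ae.
pose S k := [set y | [exists x in level a k, (a ^+ k) x == Some y]].
have SP k x y : x \in level a k -> (a ^+ k) x = Some y -> y \in S k.
  by move=> xk ax; rewrite inE; apply/existsP; exists x; rewrite xk ax /=.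
have cardS k : #|S k| = #|level a k|.
  pose f x := odflt x ((a ^+ k) x).
  have fP x : x \in level a k -> (a ^+ k) x = Some (f x).
    by rewrite inE /f; case: (_ x).
  rewrite -(@card_in_imset _ _ f (level a k)); last first.
    move=> x y /fP ax /fP ay exy; apply: (@pbijP _ (a ^+ k) _ _ _ ax); by rewrite exy.
  apply: eq_card => y; rewrite inE; apply/existsP/imsetP.
    by case=> x /andP[xk /eqP ax]; exists x => //; move: ax; rewrite fP // => -[->].
  by case=> x xk ->; exists x; rewrite xk fP //=.
have nestS k : S k.+1 \subset S k.
  apply/subsetP => y; rewrite inE => /existsP[x /andP[xk /eqP]].
  rewrite pexpSEr; case ax: (a x) => [z|//] /= az.
  by apply: SP az; rewrite -(level_step _ ax).
have S0 k : n <= k -> S k = set0.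
  by move=> /(level_eq0 a) l0; apply/eqP; rewrite -cards_eq0 cardS l0 cards0.
have [r rI rS] := nested_index nestS S0.
have lev_nc k x : x \in level a k -> x \notin fixpts a w.
  rewrite inE => /andP[_ /eqP ak]; apply/negP => /(omega_defined ow k.+1).
  by rewrite ak.
have ht_uniq k x : x \in level a k -> ht x = k.
  by move=> xk; apply: level_uniq (lev _ (lev_nc _ _ xk)) xk.
have coordI x y : x \notin fixpts a w -> y \notin fixpts a w ->
    r (e x) = r (e y) -> ht x = ht y -> x = y.
  move=> /pP[ax _] /pP[ay _] /rI exy hxy.
  by apply: (pbijP ax); rewrite -/(e x) exy -/(ht x) hxy.
have coordS x y : x \notin fixpts a w -> a x = Some y ->
    [/\ y \notin fixpts a w, r (e y) = r (e x) & ht x = (ht y).+1].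
  move=> xA ax.
  have yA : y \notin fixpts a w.
    apply: contraNN xA => yA; apply: (@omega_ge _ _ ow _ w.+1) => //.
    by rewrite pexpSEr ax (omega_defined ow).
  have htx : ht x = (ht y).+1 by apply: ht_uniq; rewrite (level_step _ ax) lev.
  split=> //; congr r.
  have [ex _] := pP _ xA; have [ey _] := pP _ yA.
  by move: ex; rewrite -/(ht x) htx pexpSEr ax /= ey => -[].
exists (r \o e), ht; split=> [x xA|i j ij|x y|x y xA] /=.
- by rewrite -cardS rS; have [ax _] := pP _ xA; apply: SP (lev _ xA) ax.
- have ltr (y : 'I_n) : y \in S j -> r y < #|S j| by rewrite rS.
  have [y yS ry] : exists2 y, y \in S j & r y = i.
    pose f (y : {y | y \in S j}) := Ordinal (ltr (val y) (valP y)).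
    have fI : injective f by move=> y z /(congr1 val) /rI /val_inj.
    have /(inj_card_onto fI) onto : #|{: 'I_#|S j|}| <= #|{: {y | y \in S j}}|.
      by rewrite card_ord card_sig.
    rewrite -cardS in ij; have /codomP[y ey] := onto (Ordinal ij).
    by exists (val y); [exact: valP | rewrite -[i]/(val (Ordinal ij)) ey].
  move: yS; rewrite inE => /existsP[x /andP[xj /eqP ax]].
  have xA := lev_nc _ _ xj; exists x; split=> //; last exact: ht_uniq.
  have [ex _] := pP _ xA; rewrite -/(ht x) (ht_uniq _ _ xj) ax in ex.
  by rewrite /= /e -(Some_inj ex).
- exact: coordI.
split=> [/coordS|[yA ryx hxy]]; first exact.
have [z az] : exists z, a x = Some z.
  by have := lev _ xA; rewrite hxy => /level_step_ex[z az _]; exists z.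
have [zA rz hz] := coordS _ _ xA az.
by rewrite az; congr Some; apply: coordI => //; rewrite ?rz //; apply: succn_inj; rewrite -hz.
Qed.

(** * Chain lengths under ~p and ~i *)

(** Let [x] have level [k.+1] under [a] and let [y = v x]. From [y], [b] allows [k] steps but not
    [k.+2], so [y] or [b y], which is [v (a x)], has level [k]; this point is chosen as the image of
    [x]. *)
Lemma level_swap n (u v : pbij n) k : #|level (u * v) k.+1| <= #|level (v * u) k|.
Proof.
set a := u * v; set b := v * u.
have swap j x y : v x = Some y -> (b ^+ j) y = obind v ((a ^+ j) x).
  by move=> vx; have := congr1 (fun s : pbij n => s x) (expg_swap u v j);
    rewrite /= (pmulE v) (pmulE _ v) vx /= => ->.
pose hit x y := v x = Some y \/ (v * a) x = Some y.
have /fin_all_exists[f fP] x : exists y, x \in level a k.+1 -> hit x y /\ y \in level b k.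
  case xl: (x \in level a k.+1); last by exists x.
  have [x' ax _] := level_step_ex xl.
  have [y vx] : exists y, v x = Some y.
    by move: ax; rewrite pmulE; case: (v x) => // y; exists y.
  have bS j : (a ^+ j.+1) x = obind u ((b ^+ j) y).
    by rewrite (swap _ _ _ vx) pexpSE; case: (_ x) => //= z; rewrite pmulE.
  have [bk bk2] : (b ^+ k) y != None /\ (b ^+ k.+2) y = None.
    move: (xl); rewrite inE (swap k.+2 _ _ vx) => /andP[ak /eqP ->]; split=> //.
    by apply: contraNN ak; rewrite bS => /eqP ->.
  case bk1: ((b ^+ k.+1) y == None).
    by exists y => _; split; [left | rewrite inE bk bk1].
  have [z bz] : exists z, b y = Some z.
    by move: bk1; rewrite pexpSEr; case: (b y) => // z; exists z.
  exists z => _; split; first by right; rewrite -bz -[b y]/((b ^+ 1) y) (swap _ _ _ vx) expg1 pmulE.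
  by move: bk1 bk2; rewrite inE !(pexpSEr _ _ y) bz /= => -> ->.
rewrite -(@card_in_imset _ _ f (level a k.+1)); last first.
  (* Choices of different kinds cannot collide: [v x = v (a y)] forces [x = a y], which has level
     [k] and not [k.+1]. *)
  have mix x y z : x \in level a k.+1 -> y \in level a k.+1 ->
      v x = Some z -> (v * a) y = Some z -> False.
    move=> xl yl vx; rewrite pmulE; case ay: (a y) => [y'|//] /= vy.
    move: yl; rewrite (level_step _ ay) -(pbijP vx vy) => xl'.
    by have := level_uniq xl xl'; lia.
  move=> x y xl yl exy; have [hx _] := fP x xl; have [hy _] := fP y yl.
  rewrite exy in hx; case: hx hy => [hx|hx] [hy|hy].
  - exact: pbijP hx hy.
  - by case: (mix _ _ _ xl yl hx hy).
  - by case: (mix _ _ _ yl xl hy hx).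
  - exact: pbijP hx hy.
by apply/subset_leq_card/subsetP => _ /imsetP[x /fP[_ fx] ->].
Qed.

Definition interlaced n (a b : pbij n) :=
  forall k, k < n -> #|level a k.+1| <= #|level b k| /\ #|level b k.+1| <= #|level a k|.

Lemma sim_p_interlaced n (a b : pbij n) : sim_p a b -> interlaced a b.
Proof. by case=> u [v [-> ->]] k _; split; apply: level_swap. Qed.

Definition same_levels n (a b : pbij n) :=
  forall k, k < n -> #|level a k| = #|level b k|.

Lemma card_defined n (a : pbij n) k :
  #|[set x | (a ^+ k) x != None]| =
    (#|level a k| + #|[set x | (a ^+ k.+1) x != None]|)%N.
Proof.
rewrite -(cardsID (level a k)) setIC; congr (_ + _)%N; apply: eq_card => x.
  by rewrite !inE andbAC andbb.
by rewrite !inE pexpSE; case: ((a ^+ k) x) => //= y; rewrite andbT.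
Qed.

(** Here [b] absorbs [s * s^-1], so [expg_swap] applies to [s^-1] and [b * s]. The exponent is
    positive because [s^-1 * s] may be a proper partial identity. *)
Lemma conj_expg n (a b s : pbij n) k :
  s * a * s^-1 = b -> s^-1 * b * s = a -> a ^+ k.+1 = s^-1 * b ^+ k.+1 * s.
Proof.
move=> sa sb; have bs : b * s * s^-1 = b.
  apply/val_inj/ffunP => x; rewrite -mulgA !pmulE.
  case sx: (s^-1 x) => [y|] /=; first by rewrite (pinvP s y x).1.
  by rewrite -sa pmulE sx.
have e : s^-1 * (b * s) = a by rewrite mulgA.
have := expg_swap s^-1 (b * s) k; rewrite e bs => sw.
by rewrite expgS -{1}e -mulgA sw (expgSr b) !mulgA.
Qed.

Lemma conj_defined n (a b s : pbij n) k :
    s * a * s^-1 = b -> s^-1 * b * s = a ->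
  #|[set x | (a ^+ k) x != None]| <= #|[set x | (b ^+ k) x != None]|.
Proof.
case: k => [|k] sa sb.
  by apply/subset_leq_card/subsetP => x _; rewrite inE poneE.
apply: (@leq_card_pbij _ s) => x; rewrite inE (conj_expg k sa sb) !pmulE.
case sx: (s x) => [y|//] /=; rewrite pmulE => bk; exists y => //.
by rewrite inE; case: (_ y) bk.
Qed.

Lemma sim_i_levels n (a b : pbij n) : sim_i a b -> same_levels a b.
Proof.
case=> s [sa sb] k _.
have eqd j : #|[set x | (a ^+ j) x != None]| = #|[set x | (b ^+ j) x != None]|.
  apply/eqP; rewrite eqn_leq (conj_defined j sa sb) /=.
  by apply: (@conj_defined _ _ _ s^-1); rewrite invgK.
by apply/eqP; rewrite -(eqn_add2r #|[set x | (a ^+ k.+1) x != None]|) {2}eqd -!card_defined eqd.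
Qed.

Lemma sim_i_p n (a b : pbij n) : sim_i a b -> sim_p a b.
Proof.
case=> s [sa sb]; exists s^-1, (s * a); split=> //.
have ss : s^-1 * s * s^-1 = s^-1.
  apply/val_inj/ffunP => x; rewrite -mulgA !pmulE; case sx: (s^-1 x) => [y|//] /=.
  by rewrite ((pinvP s y x).1 sx).
by rewrite mulgA -{2}sb !mulgA ss sb.
Qed.

(* On the noncyclic points [v] keeps the row, and lowers the height by one in *)
(* the rows [i] with [c i]; [u] is glued with the complement of [c], so that  *)
(* [u * v] and [v * u] lower it by one in every row.                          *)
Definition glued n (w : nat) (a b v v0 : pbij n) (ra ha rb hb : 'I_n -> nat) (c : nat -> bool) :=
  forall x y, (v x = Some y) <-> (v0 x = Some y) \/
    [/\ x \notin fixpts a w, y \notin fixpts b w, ra x = rb y & ha x = (hb y + c (ra x))%N].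

Lemma gluedP n w (a b v0 : pbij n) ra ha rb hb c :
    chain_coords w a ra ha -> chain_coords w b rb hb ->
    (forall x y, v0 x = Some y -> (x \in fixpts a w) && (y \in fixpts b w)) ->
  exists v, glued w a b v v0 ra ha rb hb c.
Proof.
move=> [_ _ injA _] [_ _ injB _] v0P.
pose R x y := (v0 x == Some y) || 
    [&& x \notin fixpts a w, y \notin fixpts b w, ra x == rb y & ha x == hb y + c (ra x)]%N.
have [|x y z|v vP] := @pbij_of_rel n R.
- move=> x y z /orP[/eqP vx|/and4P[xA yB /eqP exy /eqP hxy]]
  /orP[/eqP vx'|/and4P[xA' zB /eqP exz /eqP hxz]].
  + by move: vx'; rewrite vx => -[].
  + by have /andP[] := v0P _ _ vx; rewrite (negPf xA').
  + by have /andP[] := v0P _ _ vx'; rewrite (negPf xA).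
  + by apply: injB => //; [rewrite -exy | apply: (@addIn (c (ra x))); rewrite -hxy].
- move=> /orP[/eqP vx|/and4P[xA zB /eqP exy /eqP hxy]]
  /orP[/eqP vx'|/and4P[xA' zB' /eqP exz /eqP hxz]].
  + exact: pbijP vx vx'.
  + by have /andP[_] := v0P _ _ vx; rewrite (negPf zB').
  + by have /andP[_] := v0P _ _ vx'; rewrite (negPf zB).
  + by apply: injA => //; [rewrite exy | rewrite hxy hxz exy exz].
exists v => x y; split.
  move/vP/orP => [/eqP|/and4P[xA yB /eqP exy /eqP hxy]]; [by left | by right].
by move=> H; apply/vP/orP; case: H => [->|[-> -> -> ->]]; [left | right; rewrite !eqxx].
Qed.

(** In row [i], [v] followed by [u] lowers the height by [c i + ~~ c i = 1], as [a] does. The last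
    hypothesis says that the intermediate point exists in the diagram of [b]. *)
Lemma glued_mul n w (a b u v u0 v0 : pbij n) ra ha rb hb c :
    is_omega n w -> chain_coords w a ra ha -> chain_coords w b rb hb ->
    (forall x y, v0 x = Some y -> (x \in fixpts a w) && (y \in fixpts b w)) ->
    (forall y x, u0 y = Some x -> (y \in fixpts b w) && (x \in fixpts a w)) ->
    u0 * v0 = a ^+ w.+1 ->
    glued w a b v v0 ra ha rb hb c ->
    glued w b a u u0 rb hb ra ha (fun i => ~~ c i) ->
    (forall i j, i < #|level a j.+1| -> i < #|level b (j.+1 - c i)|) ->
  a = u * v.
Proof.
move=> ow [bdA surjA injA stepA] [bdB surjB injB stepB] v0P u0P uv0 vP uP fits.
apply: pbij_ext => x z; rewrite pmulE; case xA: (x \in fixpts a w).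
  have -> : a x = (a ^+ w.+1) x by rewrite pexpSE; move: xA; rewrite inE => /eqP ->.
  rewrite -uv0 pmulE; split.
    case vx: (v0 x) => [y|//] /= uy.
    by rewrite (vP x y).2 /=; [apply/uP; left | left].
  case vx: (v x) => [y|//] /=; move/vP: vx => [vx|[]]; last by rewrite xA.
  by rewrite vx /= => /uP[//|[]]; have /andP[_ ->] := v0P _ _ vx.
split.
  move/(stepA _ _ (negbT xA)) => [zA rzx hxz].
  have := bdA _ (negbT xA); rewrite hxz => /fits/surjB[y [yB ryx hyx]].
  rewrite (vP x y).2 /=; last first.
    by right; split; rewrite ?xA // hxz hyx; case: (c _); rewrite ?subn0 ?addn0 ?subn1 ?addn1.
  apply/uP; right; split=> //; first by rewrite ryx rzx.
  by rewrite hyx ryx; case: (c _); rewrite ?subn0 ?addn0 ?subn1 ?addn1.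
case vx: (v x) => [y|//] /=; move/vP: vx => [vx|[_ yB exy hxy]].
  by have /andP[] := v0P _ _ vx; rewrite xA.
move=> /uP[uy|[_ zA eyz hyz]]; first by have /andP[] := u0P _ _ uy; rewrite (negPf yB).
apply/stepA; rewrite ?xA //; split=> //; first by rewrite exy.
by rewrite hxy hyz exy -addnA; case: (c _); rewrite addn1.
Qed.

Lemma same_cycles_factor n w (a b : pbij n) : is_omega n w -> same_cycles a b ->
  exists u v : pbij n,
  [/\ u * v = a ^+ w.+1, v * u = b ^+ w.+1,
      forall x y, v x = Some y -> (x \in fixpts a w) && (y \in fixpts b w),
      forall y x, u y = Some x -> (y \in fixpts b w) && (x \in fixpts a w) &
      forall y, y \in fixpts b w -> u y != None].
Proof.
move=> ow /(cyclic_conj ow)[g [g1 g2 g3]].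
have gP x y : g x = Some y -> (y \in fixpts b w) && (x \in fixpts a w).
  move=> gx; have gy := pinv_id gx.
  by rewrite !(fixpts_omega ow) -g1 -g2 !pmulE gy /= gx /= gy.
exists g^-1, (g * a ^+ w.+1); split.
- by rewrite mulgA g1 -expgnDr addnC expgnDr omegaS_omega.
- by rewrite g3 -mulgA g2 omegaS_omega.
- move=> x y; rewrite pmulE; case ax: ((a ^+ w.+1) x) => [z|//] /= /gP/andP[-> _].
  by rewrite andbT; apply: (@omega_ge _ _ ow _ w.+1); rewrite ?ax.
- by move=> y x /pinvP/gP.
move=> y; rewrite (fixpts_omega ow) -g2 pmulE; by case: (g^-1 y).
Qed.

Lemma interlacedS n (a b : pbij n) : interlaced a b -> interlaced b a.
Proof. by move=> ab k /ab[]. Qed.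

Lemma interlaced_all n (a b : pbij n) k : interlaced a b -> #|level a k.+1| <= #|level b k|.
Proof.
move=> ab; case: (ltnP k n) => [/ab[]//|lenk].
by rewrite level_eq0 ?cards0 // ltnW.
Qed.

Lemma same_levels_all n (a b : pbij n) k : same_levels a b -> #|level a k| = #|level b k|.
Proof.
by move=> ab; case: (ltnP k n) => [/ab//|lenk]; rewrite !level_eq0.
Qed.

(** Rows of equal rank differ in length by at most one. Where the row of [a] is at least as long,
    [v] makes the step down, elsewhere [u] does, so the map keeping the height goes from the shorter
    row into the longer one. If all lengths agree, [u] always keeps the height and is total. *)
Lemma interlaced_factor n (a b : pbij n) : same_cycles a b -> interlaced a b ->
  exists u v : pbij n, [/\ a = u * v, b = v * u &
    same_levels a b -> forall y, u y != None].
Proof.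
move=> cab iab; have [w ow] := omega_exists n.
have [u0 [v0 [uv0 vu0 v0P u0P u0T]]] := same_cycles_factor ow cab.
have [ra [ha cA]] := chain_coordsP a ow; have [rb [hb cB]] := chain_coordsP b ow.
(* The row [i] of [a] is at least as long as that of [b].                     *)
pose c i := [forall j : 'I_n, (i < #|level b j|) ==> (i < #|level a j|)].
have cT i j : c i -> i < #|level b j| -> i < #|level a j|.
  case: (ltnP j n) => [ltjn|lejn]; last by rewrite (level_eq0 b lejn) cards0.
  by move=> /forallP/(_ (Ordinal ltjn))/implyP.
(* A height reached by row [i] of [b] but not of [a] lies above all of row [i] of [a], since level
   sizes decrease with the height. *)
have cF i j : ~~ c i -> i < #|level a j| -> i < #|level b j|.
  rewrite negb_forall => /existsP[k]; rewrite negb_imply -leqNgt => /andP[ib ia] ja.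
  apply: leq_trans ib (leq_level b _); rewrite leqNgt; apply/negP => /ltnW/(leq_level a).
  by move=> la; have := leq_trans ja (leq_trans la ia); rewrite ltnn.
have [v vP] := gluedP c cA cB v0P.
have [u uP] := gluedP (fun i => ~~ c i) cB cA u0P.
exists u, v; split.
- apply: (glued_mul ow cA cB v0P u0P uv0 vP uP) => i j; case ci: (c i) => ia.
    by rewrite subn1; apply: leq_trans ia (interlaced_all _ iab).
  by rewrite subn0; apply: cF; rewrite ?ci.
- have vP' : glued w a b v v0 ra ha rb hb (fun i => ~~ ~~ c i).
    by move=> x y; rewrite negbK; apply: vP.
  apply: (glued_mul ow cB cA u0P v0P vu0 uP vP') => i j; case ci: (c i) => ib.
    by rewrite subn0; apply: cT; rewrite ?ci.
  by rewrite subn1; apply: leq_trans ib (interlaced_all _ (interlacedS iab)).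
move=> lab y; case yB: (y \in fixpts b w).
  by case uy: (u0 y) (u0T y yB) => [x|//] _; rewrite (uP y x).2 //; left.
have ci i : c i by apply/forallP => j; rewrite (same_levels_all j lab) implybb.
case: cB => bdB _ _ _; have := bdB _ (negbT yB); rewrite -(same_levels_all _ lab).
case: cA => _ surjA _ _ => /surjA[x [xA rx hx]].
by rewrite (uP y x).2 //; right; rewrite yB ci addn0.
Qed.

Lemma sim_pP n (a b : pbij n) : sim_p a b <-> same_cycles a b /\ interlaced a b.
Proof.
split=> [ab|[cab /(interlaced_factor cab)[u [v [auv bvu _]]]]]; last by exists u, v.
split; last exact: sim_p_interlaced.
by move=> k /andP[k0 _]; apply: sim_p_fixpts.
Qed.

(** A total [u] is a permutation by finiteness, so [a = u * v] and [b = v * u] give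
    [b = u^-1 * a * u]. *)
Lemma sim_iP n (a b : pbij n) : sim_i a b <-> same_cycles a b /\ same_levels a b.
Proof.
split=> [ab|[cab lab]].
  have /sim_pP[cab _] := sim_i_p ab; split=> //; exact: sim_i_levels.
have iab : interlaced a b.
  by move=> k _; rewrite !(same_levels_all _ lab); split; apply: leq_level.
have [u [v [auv bvu /(_ lab) uT]]] := interlaced_factor cab iab.
have uVu : u^-1 * u = 1.
  apply/val_inj/ffunP => y; rewrite pmulE poneE; case uy: (u y) (uT y) => [x|//] _.
  exact: pinv_id uy.
have uuV : u * u^-1 = 1.
  have fI : injective (fun y => odflt y (u y)).
    move=> y y'; case uy: (u y) (uT y) => [x|//] _; case uy': (u y') (uT y') => [x'|//] _ /= exx.
    by rewrite exx in uy; apply: pbijP uy uy'.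
  apply/val_inj/ffunP => x; rewrite pmulE poneE.
  have /codomP[y ey] := injF_onto fI x.
  case uy: (u y) (uT y) ey => [x'|//] _ /= ->.
  by rewrite (pinv_id uy).
exists u^-1; rewrite invgK; split.
  by rewrite auv mulgA uVu mul1g -bvu.
by rewrite bvu -!mulgA uuV mulg1 -auv.
Qed.

Local Close Scope group_scope.

(** * The decision program *)

(** Registers are given by a list, 0 beyond its end, so that loop-free code can be evaluated by
    computation. The memory is the same before and after, as the program only reads it. *)
Definition runs (m : nat -> nat) (c : cmd) (s : seq nat) (T : nat) (s' : seq nat) :=
  forall st, reg st =1 nth 0 s -> Defs.mem st =1 m ->
  exists t st', [/\ exec c st t st', t <= T, reg st' =1 nth 0 s' & Defs.mem st' =1 m].

Lemma bits_leq v : bits v <= v.+1.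
Proof.
rewrite ltnS; case: v => [|v]; first by [].
have := trunc_logP (isT : 1 < 2) (isT : 0 < v.+1).
by apply: leq_trans; apply/ltnW/ltn_expl.
Qed.

Fixpoint plain c :=
  match c with
  | Write _ _ | While _ _ => false
  | Seq c1 c2 | If _ c1 c2 => plain c1 && plain c2
  | _ => true
  end.

Fixpoint sem m c s :=
  match c with
  | Const d k => set_nth 0 s d k
  | Add d x y => set_nth 0 s d (nth 0 s x + nth 0 s y)
  | Defs.Sub d x y => set_nth 0 s d (nth 0 s x - nth 0 s y)
  | Read d x => set_nth 0 s d (m (nth 0 s x))
  | Seq c1 c2 => sem m c2 (sem m c1 s)
  | If x c1 c2 => if nth 0 s x is 0 then sem m c2 s else sem m c1 s
  | _ => s
  end.

(** Overestimates the logarithmic cost by charging [v.+1] for a value [v]. This is affordable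
    because the values met stay linear in [n], which is below the input size. *)
Fixpoint cost (m : nat -> nat) c s :=
  match c with
  | Const d k => k.+1
  | Add d x y | Defs.Sub d x y => nth 0 s x + nth 0 s y + 2
  | Read d x => nth 0 s x + m (nth 0 s x) + 2
  | Seq c1 c2 => cost m c1 s + cost m c2 (sem m c1 s)
  | If x c1 c2 => (nth 0 s x).+1 + if nth 0 s x is 0 then cost m c2 s else cost m c1 s
  | _ => 1
  end.

Lemma runs_plain m c s : plain c -> runs m c s (cost m c s) (sem m c s).
Proof.
have setP st d v s0 : reg st =1 nth 0 s0 -> reg (set_reg st d v) =1 nth 0 (set_nth 0 s0 d v).
  by move=> rs x; rewrite nth_set_nth /= rs.
have bits2 u v : bits u + bits v <= u + v + 2.
  by have := bits_leq u; have := bits_leq v; lia.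
elim: c s => [|d k|d x y|d x y|d x|x y|c1 IH1 c2 IH2|x c1 IH1 c2 IH2|x c _] s //=.
- by move=> _ st rs ms; exists 1, st; split=> //; constructor.
- by move=> _ st rs ms; exists (bits k); eexists; split; first constructor;
    rewrite ?bits_leq //; apply: setP.
- move=> _ st rs ms; rewrite -!rs; do 2!eexists; split; first constructor => //;
    [exact: bits2 | exact: setP | exact: ms].
- move=> _ st rs ms; rewrite -!rs; do 2!eexists; split; first constructor => //;
    [exact: bits2 | exact: setP | exact: ms].
- move=> _ st rs ms; rewrite -!rs -!ms; do 2!eexists; split; first constructor => //;
    [exact: bits2 | exact: setP | exact: ms].
- move=> /andP[p1 p2] st rs ms.
  have [t1 [st1 [e1 l1 r1 m1]]] := IH1 s p1 st rs ms.
  have [t2 [st2 [e2 l2 r2 m2]]] := IH2 _ p2 st1 r1 m1.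
  by exists (t1 + t2), st2; split=> //; [exact: ExecSeq e1 e2 | exact: leq_add].
move=> /andP[p1 p2] st rs ms; rewrite -rs; case rx: (reg st x) => [|v].
  have [t [st' [e l r m']]] := IH2 s p2 st rs ms.
  exists (bits 0 + t), st'; split=> //.
  by rewrite -rx; apply: ExecIfF.
have [t [st' [e l r m']]] := IH1 s p1 st rs ms.
exists (bits v.+1 + t), st'; split=> //; last by have := bits_leq (reg st x); rewrite rx; lia.
by rewrite -rx; apply: ExecIfT; rewrite // rx.
Qed.

Lemma runs_block m c s T s' :
  plain c -> sem m c s = s' -> cost m c s <= T -> runs m c s T s'.
Proof.
move=> pc <- leT st rs ms; have [t [st' [e l r m']]] := @runs_plain m c s pc st rs ms.
by exists t, st'; split=> //; apply: leq_trans l leT.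
Qed.

Lemma runs_seq m c1 c2 s s1 s2 T1 T2 :
  runs m c1 s T1 s1 -> runs m c2 s1 T2 s2 -> runs m (Seq c1 c2) s (T1 + T2) s2.
Proof.
move=> H1 H2 st rs ms.
have [t1 [st1 [e1 l1 r1 m1]]] := H1 st rs ms.
have [t2 [st2 [e2 l2 r2 m2]]] := H2 st1 r1 m1.
by exists (t1 + t2), st2; split=> //; [exact: ExecSeq e1 e2 | exact: leq_add].
Qed.

Lemma runs_leq m c s s' T T' : T <= T' -> runs m c s T s' -> runs m c s T' s'.
Proof.
move=> leT H st rs ms; have [t [st' [e l r m']]] := H st rs ms.
by exists t, st'; split=> //; apply: leq_trans l leT.
Qed.

(* [S i] is the state in which [i] rounds of the loop remain.                 *)
Lemma runs_while m r c (S : nat -> seq nat) N T :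
    (forall i, nth 0 (S i) r = i) ->
    (forall i, i < N -> runs m c (S i.+1) T (S i)) ->
  runs m (While r c) (S N) (N * (T + N + 1) + 1) (S 0).
Proof.
move=> Sr; suff H M : M <= N -> (forall i, i < M -> runs m c (S i.+1) T (S i)) ->
    runs m (While r c) (S M) (M * (T + N + 1) + 1) (S 0) by exact: H.
elim: M => [_ _|M IHM ltMN H] st rs ms.
  have r0 : reg st r = 0 by rewrite rs Sr.
  by exists (bits (reg st r)), st; split=> //; [exact: ExecWhileF | rewrite r0 bits_leq].
have [t1 [st1 [e1 l1 r1 m1]]] := H M (ltnSn M) st rs ms.
have [|t2 [st2 [e2 l2 r2 m2]]] := IHM (ltnW ltMN) _ st1 r1 m1.
  by move=> i ltiM; apply: H; apply: ltnW.
exists (bits (reg st r) + t1 + t2), st2; split=> //.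
  by apply: ExecWhileT e1 e2; rewrite rs Sr.
rewrite rs Sr; have := bits_leq M.+1; nia.
Qed.

(** * The counting loop *)

Definition block := foldr Seq Skip.

(* Registers: 0 answer, 1 n, 2 the constant 1, 3 loop counter, 4 offset of    *)
(* the partial bijection in memory, 5 number k of steps, 6 current point,     *)
(* 7 its image, 8 and 9 scratch, 10 and 11 results of [count_cmd], 12 to 17    *)
(* saved results. Register 18 is never written, hence 0.                      *)
Definition copy d x := Add d x 18.

(** Points are coded as in the input, [x.+1] for [x] and 0 for undefined. As cell 0 holds [n], a
    nonzero code plus the offset, 0 for [a] and [n] for [b], is the address of the code of its
    image. *)
Definition step_cmd := If 7 (block [:: Add 9 7 4; Read 7 9; Const 9 0]) Skip.

(** One step beyond the [k] already made, so a single pass counts both the fixed points of the power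
    [k.+1] and the points of level [k]. *)
Definition tally_cmd :=
  If 7 (Seq step_cmd
    (If 7 (block [:: Defs.Sub 9 7 6; Defs.Sub 8 6 7; Add 9 9 8; If 9 Skip (Add 10 10 2)])
          (Add 11 11 2)))
    Skip.

Definition count_body :=
  Seq (Seq (copy 7 6) (copy 8 5))
  (Seq (While 8 (Seq step_cmd (Defs.Sub 8 8 2)))
       (Seq tally_cmd (block [:: Const 7 0; Const 8 0; Const 9 0; Defs.Sub 6 6 2]))).

Definition count_cmd :=
  Seq (block [:: Const 10 0; Const 11 0; copy 6 1]) (While 6 count_body).

Section Count.
Variables (m : nat -> nat) (n : nat).
Hypothesis m_leq : forall v, m v <= n.

Definition move off v := if v is 0 then 0 else m (v + off).
Definition fixes off k p := iter k.+1 (move off) p == p.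
Definition ends off k p := (iter k (move off) p != 0) && (iter k.+1 (move off) p == 0).
Definition fix_count off k := \sum_(0 <= p < n) fixes off k p.+1.
Definition end_count off k := \sum_(0 <= p < n) ends off k p.+1.

Lemma move_leq off v : move off v <= n.
Proof. by case: v => [|v]; rewrite ?m_leq. Qed.

Lemma sum_bool_leq i (P : nat -> bool) : \sum_(i <= p < n) P p <= n.
Proof.
apply: (@leq_trans (\sum_(i <= p < n) 1)); last by rewrite sum_nat_const_nat muln1 leq_subr.
by apply: leq_sum => p _; case: (P p).
Qed.

Variables (ans k off kk r12 r13 r14 r15 r16 r17 : nat).
Hypotheses (off_leq : off <= n) (kk_leq : kk <= n).

Let state i x j f c :=
  [:: ans; n; 1; k; off; kk; i; x; j; 0; f; c; r12; r13; r14; r15; r16; r17].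

Lemma runs_step i x f c : i <= n -> x <= n ->
  runs m (While 8 (Seq step_cmd (Defs.Sub 8 8 2))) (state i x kk f c)
    (20 * (n.+1 * n.+1)) (state i (iter kk (move off) x) 0 f c).
Proof.
move=> lein lexn.
pose S j := state i (iter (kk - j) (move off) x) j f c.
have := @runs_while m 8 (Seq step_cmd (Defs.Sub 8 8 2)) S kk (10 * n.+1) (fun=> erefl).
rewrite /S subnn subn0 => H; apply: runs_leq (H _); first nia.
move=> j ltj; have -> : kk - j = (kk - j.+1).+1 by lia.
rewrite iterS; set y := iter (kk - j.+1) _ x.
have ley : y <= n by rewrite /y; case: (kk - j.+1) => //= d; apply: move_leq.
apply: runs_block => //.
  by rewrite /state; case: y ley => [|y] _; rewrite /= subn1.
rewrite /state; case: y ley => [|y] ley /=; first lia.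
by have := m_leq (y.+1 + off); lia.
Qed.

Lemma runs_count_body i f c : i < n -> f <= n -> c <= n ->
  runs m count_body (state i.+1 0 0 f c) (100 * (n.+1 * n.+1))
    (state i 0 0 (fixes off kk i.+1 + f) (ends off kk i.+1 + c)).
Proof.
move=> ltin lefn lecn; set x := iter kk (move off) i.+1.
have lex : x <= n by rewrite /x; case: {+}kk => //= d; apply: move_leq.
apply: (@runs_leq _ _ _ _ (10 * n.+1 + (20 * (n.+1 * n.+1) + (40 * n.+1 + 20 * n.+1)))); first nia.
apply: runs_seq (_ : runs m _ _ _ (state i.+1 i.+1 kk f c)) _.
  by apply: runs_block; rewrite //= ?addn0 //; lia.
apply: runs_seq (@runs_step i.+1 i.+1 f c ltin ltin) _; rewrite -/x.
have xS : iter kk.+1 (move off) i.+1 = move off x by [].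
pose y := move off x.
(* Registers 8 and 9 still hold the differences of the equality test if it was reached, and 0
   otherwise; the last block clears them. *)
apply: runs_seq (_ : runs m _ _ _
  [:: ans; n; 1; k; off; kk; i.+1; y; if (x != 0) && (y != 0) then i.+1 - y else 0;
    if (x != 0) && (y != 0) then y - i.+1 + (i.+1 - y) else 0;
    fixes off kk i.+1 + f; ends off kk i.+1 + c; r12; r13; r14; r15; r16; r17]) _.
  rewrite /fixes /ends xS -/x /y; have := move_leq off x.
  move: lex; clear xS y; clearbody x => lex ley; apply: runs_block => //; rewrite /state.
    case: x lex ley => [|x'] // lex ley; rewrite /=.
    case: (m (x'.+1 + off)) => [|y'] /=; first by rewrite addn1.
    case: eqP => [->|ne]; first by rewrite subnn /= addn1 add0n.
    by case E: (y'.+1 - i.+1 + (i.+1 - y'.+1)) => [|d] /=; [lia |].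
  case: x lex ley => [|x'] lex /=; first lia.
  case: (m (x'.+1 + off)) => [|y'] /= ley; first lia.
  by case E: (y'.+1 - i.+1 + (i.+1 - y'.+1)) => [|d]; lia.
apply: runs_block; rewrite //= ?subn1 //; lia.
Qed.

Lemma runs_count f c :
  runs m count_cmd (state 0 0 0 f c) (200 * (n.+1 * (n.+1 * n.+1)))
    (state 0 0 0 (fix_count off kk) (end_count off kk)).
Proof.
apply: (@runs_leq _ _ _ _ (10 * n.+1 + (n * (100 * (n.+1 * n.+1) + n + 1) + 1))); first nia.
apply: runs_seq (_ : runs m _ _ _ (state n 0 0 0 0)) _.
  by apply: runs_block; rewrite //= ?addn0 //; lia.
pose S i := state i 0 0 (\sum_(i <= p < n) fixes off kk p.+1)
  (\sum_(i <= p < n) ends off kk p.+1).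
have <- : S n = state n 0 0 0 0 by rewrite /S !big_geq.
apply: (@runs_while m 6 count_body S n (100 * (n.+1 * n.+1)) (fun=> erefl)) => i ltin.
by rewrite /S !(big_ltn ltin); apply: runs_count_body; rewrite ?sum_bool_leq.
Qed.

End Count.

(** * The tests and the main loop *)

Definition eq_cmd x y :=
  block [:: Defs.Sub 8 x y; Defs.Sub 9 y x; Add 9 8 9; If 9 (Const 0 0) Skip; Const 8 0; Const 9 0].

Definition leq_cmd x y :=
  block [:: Defs.Sub 9 x y; If 9 (Const 0 0) Skip; Const 9 0].

(* The test [tst] clears the answer unless the saved counts satisfy [P].      *)
Definition implements K tst (P : nat -> nat -> nat -> nat -> nat -> nat -> bool) :=
  forall m (ans : bool) n k kk f c fa ca fb cb ca' cb',
    fa <= n -> ca <= n -> fb <= n -> cb <= n -> ca' <= n -> cb' <= n ->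
  runs m tst [:: ans : nat; n; 1; k; n; kk; 0; 0; 0; 0; f; c; fa; ca; fb; cb; ca'; cb']
    (K * n.+1)
    [:: ans && P fa ca ca' fb cb cb' : nat; n; 1; k; n; kk; 0; 0; 0; 0; f; c;
        fa; ca; fb; cb; ca'; cb'].

Ltac solve_test :=
  move=> m ans n k kk f c fa ca fb cb ca' cb' *; apply: runs_block => //=;
  [ by repeat match goal with |- context [match ?u with 0 => _ | S _ => _ end] =>
      let E := fresh in case E: u => [|?] /= end; do !f_equal; lia
  | by repeat match goal with |- context [match ?u with 0 => _ | S _ => _ end] =>
      let E := fresh in case E: u => [|?] /= end; lia ].

Lemma eq_fixesP : implements 100 (eq_cmd 12 14) (fun fa _ _ fb _ _ => fa == fb).
Proof. solve_test. Qed.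

Lemma eq_endsP : implements 100 (eq_cmd 13 15) (fun _ ca _ _ cb _ => ca == cb).
Proof. solve_test. Qed.

Lemma leq_endsP : implements 100 (leq_cmd 16 15) (fun _ _ ca' _ cb _ => ca' <= cb).
Proof. solve_test. Qed.

Lemma geq_endsP : implements 100 (leq_cmd 17 13) (fun _ ca _ _ _ cb' => cb' <= ca).
Proof. solve_test. Qed.

Lemma implements_and K1 K2 t1 t2 P1 P2 :
  implements K1 t1 P1 -> implements K2 t2 P2 ->
  implements (K1 + K2) (Seq t1 t2)
    (fun fa ca ca' fb cb cb' => P1 fa ca ca' fb cb cb' && P2 fa ca ca' fb cb cb').
Proof.
move=> H1 H2 m ans n k kk f c fa ca fb cb ca' cb' *.
by rewrite mulnDl andbA; apply: runs_seq; [apply: H1 | apply: H2].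
Qed.

(** With [k.+1] in register 3, the four counts are for [a] and [b] at [k], then for [a] and [b] at
    [k.+1]. The final block resets the registers, so that only the answer and the counter change
    from round to round. *)
Definition main_body tst :=
  Seq (block [:: Defs.Sub 5 3 2; Const 4 0]) (
  Seq count_cmd (
  Seq (block [:: copy 12 10; copy 13 11; copy 4 1]) (
  Seq count_cmd (
  Seq (block [:: copy 14 10; copy 15 11; Add 5 5 2; Const 4 0]) (
  Seq count_cmd (
  Seq (block [:: copy 16 11; copy 4 1]) (
  Seq count_cmd (
  Seq (copy 17 11) (
  Seq tst
      (block [:: Const 4 0; Const 5 0; Const 10 0; Const 11 0; Const 12 0; Const 13 0;
                 Const 14 0; Const 15 0; Const 16 0; Const 17 0; Defs.Sub 3 3 2])))))))))).

Definition main_cmd tst :=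
  Seq (block [:: Read 1 0; Const 2 1; Const 0 1; copy 3 1]) (While 3 (main_body tst)).

Definition main_state (n : nat) (ans : bool) (k : nat) :=
  [:: ans : nat; n; 1; k; 0; 0; 0; 0; 0; 0; 0; 0; 0; 0; 0; 0; 0; 0].

Definition passes (P : nat -> nat -> nat -> nat -> nat -> nat -> bool) m n k :=
  P (fix_count m n 0 k) (end_count m n 0 k) (end_count m n 0 k.+1)
    (fix_count m n n k) (end_count m n n k) (end_count m n n k.+1).

Lemma runs_main_body K tst P m n (ans : bool) k :
    implements K tst P -> (forall v, m v <= n) -> k < n ->
  runs m (main_body tst) (main_state n ans k.+1) ((1000 + K) * (n.+1 * (n.+1 * n.+1)))
    (main_state n (ans && passes P m n k) k).
Proof.
move=> tstP mn ltkn; set T := 200 * (n.+1 * (n.+1 * n.+1)).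
have fixn off k' : fix_count m n off k' <= n := sum_bool_leq n 0 (fun p => fixes m off k' p.+1).
have endn off k' : end_count m n off k' <= n := sum_bool_leq n 0 (fun p => ends m off k' p.+1).
apply: (@runs_leq _ _ _ _ (10 * n.+1 + (T + (10 * n.+1 + (T + (10 * n.+1 + (T + (10 * n.+1 +
  (T + (10 * n.+1 + (K * n.+1 + 20 * n.+1))))))))))); first by rewrite /T; nia.
apply: runs_seq (_ : runs m _ _ _ [:: ans : nat; n; 1; k.+1; 0; k; 0; 0; 0; 0; 0; 0; 0; 0; 0; 0; 0; 0]) _.
  by apply: runs_block; rewrite //= ?subn1 //; lia.
apply: runs_seq; first by apply: runs_count => //; lia.
apply: runs_seq (_ : runs m _ _ _ [:: ans : nat; n; 1; k.+1; n; k; 0; 0; 0; 0;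
    fix_count m n 0 k; end_count m n 0 k; fix_count m n 0 k; end_count m n 0 k; 0; 0; 0; 0]) _.
  by apply: runs_block; rewrite //= ?addn0 //; have := fixn 0 k; have := endn 0 k; lia.
apply: runs_seq; first by apply: runs_count => //; lia.
apply: runs_seq (_ : runs m _ _ _ [:: ans : nat; n; 1; k.+1; 0; k.+1; 0; 0; 0; 0;
    fix_count m n n k; end_count m n n k; fix_count m n 0 k; end_count m n 0 k;
    fix_count m n n k; end_count m n n k; 0; 0]) _.
  by apply: runs_block; rewrite //= ?addn0 ?addn1 //; have := fixn n k; have := endn n k; lia.
apply: runs_seq; first by apply: runs_count => //; lia.
apply: runs_seq (_ : runs m _ _ _ [:: ans : nat; n; 1; k.+1; n; k.+1; 0; 0; 0; 0;
    fix_count m n 0 k.+1; end_count m n 0 k.+1; fix_count m n 0 k; end_count m n 0 k;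
    fix_count m n n k; end_count m n n k; end_count m n 0 k.+1; 0]) _.
  by apply: runs_block; rewrite //= ?addn0 //; have := fixn 0 k.+1; have := endn 0 k.+1; lia.
apply: runs_seq; first by apply: runs_count => //; lia.
apply: runs_seq (_ : runs m _ _ _ [:: ans : nat; n; 1; k.+1; n; k.+1; 0; 0; 0; 0;
    fix_count m n n k.+1; end_count m n n k.+1; fix_count m n 0 k; end_count m n 0 k;
    fix_count m n n k; end_count m n n k; end_count m n 0 k.+1; end_count m n n k.+1]) _.
  by apply: runs_block; rewrite //= ?addn0 //; have := fixn n k.+1; have := endn n k.+1; lia.
apply: runs_seq; first exact: tstP.
by apply: runs_block; rewrite //= ?subn1 //; lia.
Qed.

Lemma runs_main K tst P m n :
    implements K tst P -> m 0 = n -> (forall v, m v <= n) ->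
  runs m (main_cmd tst) [::] ((1020 + K) * (n.+1 * (n.+1 * (n.+1 * n.+1))))
    (main_state n (all (passes P m n) (iota 0 n)) 0).
Proof.
move=> tstP m0 mn; set T := (1000 + K) * (n.+1 * (n.+1 * n.+1)).
apply: (@runs_leq _ _ _ _ (10 * n.+1 + (n * (T + n + 1) + 1))); first by rewrite /T; nia.
apply: runs_seq (_ : runs m _ _ _ (main_state n true n)) _.
  (* The empty list and 18 zeros describe the same registers; the longer list makes the evaluation
     end in [main_state] literally. *)
  have H : runs m (block [:: Read 1 0; Const 2 1; Const 0 1; copy 3 1]) (nseq 18 0)
      (10 * n.+1) (main_state n true n).
    by apply: runs_block; rewrite //= m0 ?addn0 //; lia.
  by move=> st rs; apply: H => x; rewrite rs nth_nil nth_nseq if_same.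
pose S i := main_state n (all (passes P m n) (iota i (n - i))) i.
have <- : S n = main_state n true n by rewrite /S subnn.
have <- : S 0 = main_state n (all (passes P m n) (iota 0 n)) 0 by rewrite /S subn0.
apply: (@runs_while m 3 (main_body tst) S n T (fun=> erefl)) => i ltin.
rewrite /S -(subnSK ltin) /= andbC; exact: runs_main_body.
Qed.

(** * From the encoded input to the counts *)

Section Encoding.
Variables (n : nat) (a b : pbij n).
Let m := nth 0 (encode_input a b).

Lemma size_encode_pbij (s : pbij n) : size (encode_pbij s) = n.
Proof. by rewrite size_map size_enum_ord. Qed.

Lemma nth_encode_pbij (s : pbij n) (x : 'I_n) : nth 0 (encode_pbij s) x = encode_value (s x).
Proof. by rewrite (nth_map x) ?size_enum_ord // nth_ord_enum. Qed.

Lemma encode_value_leq (o : option 'I_n) : encode_value o <= n.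
Proof. by case: o => [x|] /=. Qed.

Lemma encode_input_leq v : m v <= n.
Proof.
case: (ltnP v (size (encode_input a b))) => [lt|ge]; last by rewrite /m nth_default.
have: m v \in encode_input a b by apply: mem_nth.
rewrite inE mem_cat => /or3P[/eqP -> //|/mapP[x _ ->]|/mapP[x _ ->]]; exact: encode_value_leq.
Qed.

Lemma encode_input_a (x : 'I_n) : m (x.+1 + 0) = encode_value (a x).
Proof. by rewrite addn0 /m /= nth_cat size_encode_pbij ltn_ord nth_encode_pbij. Qed.

Lemma encode_input_b (x : 'I_n) : m (x.+1 + n) = encode_value (b x).
Proof.
by rewrite /m /= nth_cat size_encode_pbij ltnNge leq_addl addnK nth_encode_pbij.
Qed.

Lemma move_encode off (s : pbij n) k (x : 'I_n) :
    (forall y : 'I_n, m (y.+1 + off) = encode_value (s y)) ->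
  iter k (move m off) x.+1 = encode_value ((s ^+ k)%g x).
Proof.
move=> ms; elim: k => [|k IHk]; first by rewrite poneE.
by rewrite iterS IHk pexpSE; case: ((s ^+ k)%g x) => //= y.
Qed.

Lemma encode_value_eq0 (o : option 'I_n) : (encode_value o == 0) = (o == None).
Proof. by case: o. Qed.

Lemma encode_value_eqS (o : option 'I_n) (x : 'I_n) : (encode_value o == x.+1) = (o == Some x).
Proof. by case: o. Qed.

Lemma fix_count_card off (s : pbij n) k :
    (forall y : 'I_n, m (y.+1 + off) = encode_value (s y)) ->
  fix_count m n off k = #|fixpts s k.+1|.
Proof.
move=> ms; rewrite /fix_count big_mkord -sum1_card [RHS]big_mkcond.
apply: eq_bigr => x _.
by rewrite /fixes (move_encode _ _ ms) encode_value_eqS inE; case: (_ == _).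
Qed.

Lemma end_count_card off (s : pbij n) k :
    (forall y : 'I_n, m (y.+1 + off) = encode_value (s y)) ->
  end_count m n off k = #|level s k|.
Proof.
move=> ms; rewrite /end_count big_mkord -sum1_card [RHS]big_mkcond.
apply: eq_bigr => x _.
by rewrite /ends !(move_encode _ _ ms) !encode_value_eq0 inE; case: (_ && _).
Qed.

Lemma input_size_gt : n < input_size (encode_input a b).
Proof.
rewrite /input_size big_cons -[n.+1]add1n leq_add //.
apply: (@leq_trans (\sum_(v <- encode_pbij a ++ encode_pbij b) 1)).
  by rewrite sum1_size size_cat !size_encode_pbij leq_addr.
exact: leq_sum.
Qed.

End Encoding.

(** There are [n] rounds of cubic cost, hence the exponent 4; every input entry has at least one
    bit, so [n.+1] is at most the input size. *)
Lemma ptime_decidable_counts (R : forall n, pbij n -> pbij n -> Prop) K tst P :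
    implements K tst P ->
    (forall n (a b : pbij n), R n a b <-> forall k, k < n ->
       P #|fixpts a k.+1| #|level a k| #|level a k.+1|
         #|fixpts b k.+1| #|level b k| #|level b k.+1|) ->
  ptime_decidable R.
Proof.
move=> tstP RP; exists (main_cmd tst), (1020 + K), 4 => n a b.
set input := encode_input a b.
have [||t [st [e lt rs _]]] := runs_main tstP (erefl n) (encode_input_leq a b) (st := init input).
- by move=> x; rewrite nth_nil.
- by [].
exists t, st, (all (passes P (nth 0 input) n) (iota 0 n)); split=> //.
- apply: leq_trans lt _; rewrite leq_mul2l; apply/orP; right.
  have -> : n.+1 * (n.+1 * (n.+1 * n.+1)) = n.+1 ^ 4 by rewrite !expnS expn0 muln1.
  by rewrite leq_exp2r // input_size_gt.
have pE k : passes P (nth 0 input) n k =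
    P #|fixpts a k.+1| #|level a k| #|level a k.+1|
      #|fixpts b k.+1| #|level b k| #|level b k.+1|.
  have ea := encode_input_a a b; have eb := encode_input_b a b.
  by rewrite /passes !(fix_count_card _ ea) !(end_count_card _ ea)
             !(fix_count_card _ eb) !(end_count_card _ eb).
rewrite RP; split=> [/allP ab k ltkn|ab]; first by rewrite -pE ab // mem_iota.
by apply/allP => k; rewrite mem_iota pE => /ab.
Qed.

Lemma same_cyclesP n (a b : pbij n) :
  same_cycles a b <-> forall k, k < n -> #|fixpts a k.+1| == #|fixpts b k.+1|.
Proof.
split=> ab k; first by move=> ltkn; rewrite ab.
by case: k => // k /ab/eqP.
Qed.

Theorem theorem4p5 :
  [/\ ptime_decidable sim_i,
      ptime_decidable sim_p,
      ptime_decidable sim_pstar &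
      ptime_decidable sim_tr].
Proof.
split.
- apply: (ptime_decidable_counts (implements_and eq_fixesP eq_endsP)) => n a b.
  rewrite sim_iP same_cyclesP; split=> [[cab lab] k ltkn|ab].
    by rewrite cab //=; apply/eqP/lab.
  by split=> k /ab/andP[] // _ /eqP.
- apply: (ptime_decidable_counts
    (implements_and eq_fixesP (implements_and leq_endsP geq_endsP))) => n a b.
  rewrite sim_pP same_cyclesP; split=> [[cab lab] k ltkn|ab].
    by rewrite cab //=; apply/andP/lab.
  by split=> k /ab/andP[] // _ /andP.
- by apply: (ptime_decidable_counts eq_fixesP) => n a b; rewrite sim_pstarP same_cyclesP.
- by apply: (ptime_decidable_counts eq_fixesP) => n a b; rewrite sim_trP same_cyclesP.
Qed.
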